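(* Let $d\ge 1$, let $L_\pm$ be the scalar Schrödinger operators obtained by linearizing the nonlinear Schrödinger equation about a soliton $R$ (see context), and let $$JL=\begin{pmatrix}0&L_-\\-L_+&0\end{pmatrix}$$ be the corresponding linearized operator. Let $\mathcal U\subseteq H^1(\mathbb R^d)\times H^1(\mathbb R^d)$ be a subspace and assume that $L_\pm$ satisfy the Spectral Property on $\mathcal U$. Then $JL$ has no embedded eigenvalues on $\mathcal U$; that is, there is no nonzero $\mathbf z=(u,v)^T\in\mathcal U$ that is an eigenvector of $JL$, $JL\,\mathbf z=i\tau\,\mathbf z$, with $i\tau$ ($\tau\in\mathbb R$) in the essential spectrum of $JL$.
   Context: Consider $i\psi_t+\Delta\psi+g(|\psi|^2)\psi=0$ on $\mathbb R\times\mathbb R^d$, with $g:\mathbb R\to\mathbb R$, $g\ge 0$. A soliton is a solution $\psi=e^{i\lambda t}R(\mathbf x)$ with $\lambda>0$, where $R$ is a positive, radially symmetric, exponentially decaying solution of $\Delta R-\lambda R+g(R^2)R=0$. Put $$L_-=-\Delta+\lambda-V_-,\quad V_-=g(R^2),\qquad L_+=-\Delta+\lambda-V_+,\quad V_+=g(R^2)+2g'(R^2)R^2 .$$ The nonlinearity and soliton are assumed to be such that $V_\pm$ are smooth and, together with their derivatives, exponentially decaying. The essential spectrum of $JL$ is $\{i\tau:\tau\in\mathbb R,\ |\tau|\ge\lambda\}$. Functions are complex valued and $\langle f,h\rangle=\int_{\mathbb R^d} f\,\overline h\,d\mathbf x$. Let $\Lambda f=\frac d2 f+\mathbf x\cdot\nabla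 f$ (a skew-adjoint operator), and define $$\mathcal L_\pm=\tfrac12[L_\pm,\Lambda]=\tfrac12\big(L_\pm\Lambda-\Lambda L_\pm\big)=-\Delta+\mathcal V_\pm,\qquad \mathcal V_\pm=\tfrac12\,\mathbf x\cdot\nabla V_\pm .$$ For $\mathbf z=(u,v)^T\in H^1\times H^1$ let $\mathcal B(\mathbf z,\mathbf z)=\langle\mathcal L_+u,u\rangle+\langle\mathcal L_-v,v\rangle$, understood as a quadratic form, i.e. $\int(|\nabla u|^2+\mathcal V_+|u|^2)+\int(|\nabla v|^2+\mathcal V_-|v|^2)$. Spectral Property on $\mathcal U\subseteq H^1\times H^1$: there is a constant $\delta_0>0$ such that for all nonzero $\mathbf z\in\mathcal U$, $$\mathcal B(\mathbf z,\mathbf z)>\delta_0\int_{\mathbb R^d}\big(|\nabla\mathbf z|^2+e^{-|\mathbf y|}|\mathbf z|^2\big)\,d\mathbf y .$$ *)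

(* Defs.v *)
From HB Require Import structures.
From mathcomp Require Import all_boot all_order all_algebra.
From mathcomp Require Import all_classical all_reals all_analysis.
From mathcomp Require Import complex.

Set Implicit Arguments.
Unset Strict Implicit.
Unset Printing Implicit Defensive.

Import Order.TTheory GRing.Theory Num.Theory.
Import numFieldNormedType.Exports.

Local Open Scope classical_set_scope.
Local Open Scope complex_scope.
Local Open Scope ring_scope.

(* The product sigma-algebra on row vectors, generated by the coordinates; it
   is the Borel sigma-algebra of the topology carried by ['rV[R]_n]. *)
Section measurable_rV.
Context {R : realType}.
Variable n : nat.

Let coord : 'I_n -> 'rV[R]_n -> R := fun j x => x ord0 j.

Let rV_set0 : g_sigma_preimage coord set0.
Proof. exact: sigma_algebra0. Qed.

Let rV_setC A : g_sigma_preimage coord A -> g_sigma_preimage coord (~` A).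
Proof. exact: sigma_algebraC. Qed.

Let rV_bigcup (F : _^nat) : (forall i, g_sigma_preimage coord (F i)) ->
  g_sigma_preimage coord (\bigcup_i (F i)).
Proof. exact: sigma_algebra_bigcup. Qed.

HB.instance Definition _ := @isMeasurable.Build default_measure_display
  'rV[R]_n (g_sigma_preimage coord) rV_set0 rV_setC rV_bigcup.

End measurable_rV.

Lemma measurable_coord (R : realType) n (j : 'I_n) :
  measurable_fun [set: 'rV[R]_n] (fun x : 'rV[R]_n => x ord0 j).
Proof.
move=> _ Y mY; rewrite setTI; apply: sub_sigma_algebra => /=.
rewrite -bigcup_seq/=; exists j => /=; first by rewrite mem_index_enum.
by exists Y => //; rewrite setTI.
Qed.

Lemma measurable_fun_coordP d (T : measurableType d) (R : realType) n
    (f : T -> 'rV[R]_n) :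
  (forall j, measurable_fun [set: T] (fun t => f t ord0 j)) ->
  measurable_fun [set: T] f.
Proof.
move=> mf _ Y mY; rewrite setTI.
suff: preimage_set_system [set: T] f measurable `<=` measurable.
  by apply; exists Y => //; rewrite setTI.
rewrite -(g_sigma_preimage_comp (fun j (x : 'rV[R]_n) => x ord0 j) f).
apply: smallest_sub; first exact: sigma_algebra_measurable.
rewrite -bigcup_seq => A [j _ [B mB <-]].
exact: mf.
Qed.

Definition rV_cons {R : realType} {n : nat} (p : measurableTypeR R * 'rV[R]_n)
  : 'rV[R]_n.+1 := \row_j oapp (fun k => p.2 ord0 k) p.1 (unlift ord0 j).

Definition rV_uncons {R : realType} {n : nat} (x : 'rV[R]_n.+1)
  : measurableTypeR R * 'rV[R]_n := (x ord0 ord0, \row_k x ord0 (lift ord0 k)).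

Lemma rV_consK (R : realType) n : cancel (@rV_cons R n) rV_uncons.
Proof.
case=> r x; rewrite /rV_uncons; congr (_, _); first by rewrite mxE unlift_none.
by apply/rowP => k; rewrite !mxE liftK.
Qed.

Lemma measurable_rV_cons (R : realType) n :
  measurable_fun setT (@rV_cons R n).
Proof.
apply: measurable_fun_coordP => j.
have [k ->|->] := unliftP ord0 j.
- rewrite (_ : (fun _ => _) = (fun x : 'rV[R]_n => x ord0 k) \o snd).
    exact: (measurableT_comp (@measurable_coord R n k)).
  by apply/funext => p /=; rewrite mxE liftK.
- rewrite (_ : (fun _ => _) = fst); first exact: measurable_fst.
  by apply/funext => p /=; rewrite mxE unlift_none.
Qed.

Lemma measurable_rV_uncons (R : realType) n :
  measurable_fun setT (@rV_uncons R n).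
Proof.
apply: measurable_fun_pair; first exact: measurable_coord.
apply: measurable_fun_coordP => j /=.
rewrite (_ : (fun _ => _) = fun x : 'rV[R]_n.+1 => x ord0 (lift ord0 j)).
  exact: measurable_coord.
by apply/funext => x /=; rewrite mxE.
Qed.

Section lebesgue_cons.
Local Open Scope ereal_scope.
Context {R : realType} {n : nat}.
Variable m : {sigma_finite_measure set 'rV[R]_n -> \bar R}.

Definition lebesgue_cons : set 'rV[R]_n.+1 -> \bar R :=
  pushforward (@lebesgue_measure R \x m) rV_cons.

Let lebesgue_cons0 : lebesgue_cons set0 = 0.
Proof. by rewrite /lebesgue_cons /pushforward preimage_set0 measure0. Qed.

Let lebesgue_cons_ge0 A : 0 <= lebesgue_cons A.
Proof. by rewrite /lebesgue_cons /pushforward measure_ge0. Qed.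

Let lebesgue_cons_sigma_additive : semi_sigma_additive lebesgue_cons.
Proof.
move=> F mF tF mUF; rewrite /lebesgue_cons /pushforward preimage_bigcup.
have mcons A : measurable A -> measurable (@rV_cons R n @^-1` A).
  by move=> mA; rewrite -[X in measurable X]setTI; exact: measurable_rV_cons.
apply: measure_semi_sigma_additive => //; first by move=> k; exact: mcons.
- apply/trivIsetP => /= i j _ _ ij; rewrite -preimage_setI.
  by move/trivIsetP : tF => /(_ _ _ _ _ ij) ->//; rewrite preimage_set0.
- by rewrite -preimage_bigcup; exact: mcons.
Qed.

HB.instance Definition _ := isMeasure.Build _ _ _ lebesgue_cons
  lebesgue_cons0 lebesgue_cons_ge0 lebesgue_cons_sigma_additive.

Let lebesgue_cons_sigma_finite : sigma_finite setT lebesgue_cons.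
Proof.
have [F [FT ndF Foo]] := (sigma_finiteP _ _).1 (@sigma_finiteT _ _ _
  (@lebesgue_measure R)).
have [G [GT ndG Goo]] := (sigma_finiteP _ _).1 (sigma_finiteT m).
exists (fun k => rV_uncons @^-1` (F k `*` G k)).
  apply/esym/seteqP; split=> // x _.
  have [k _ Fk] : (\bigcup_k F k) (x ord0 ord0) by rewrite -FT.
  have [l _ Gl] : (\bigcup_k G k) (rV_uncons x).2 by rewrite -GT.
  exists (maxn k l) => //; split.
    by move: Fk; exact/subsetPset/ndF/leq_maxl.
  by move: Gl; exact/subsetPset/ndG/leq_maxr.
move=> k; have [mF Fk] := Foo k; have [mG Gk] := Goo k.
have mFG := measurableX mF mG; split.
  by rewrite -[X in measurable X]setTI; exact: measurable_rV_uncons.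
rewrite /lebesgue_cons /pushforward -comp_preimage.
rewrite (_ : rV_uncons \o rV_cons = id); last first.
  by apply/funext => p /=; rewrite rV_consK.
by rewrite preimage_id product_measure1E// lte_mul_pinfty// ge0_fin_numE.
Qed.

HB.instance Definition _ := Measure_isSigmaFinite.Build _ _ _ lebesgue_cons
  lebesgue_cons_sigma_finite.

End lebesgue_cons.

Fixpoint lebesgue_rV {R : realType} (n : nat) :
    {sigma_finite_measure set 'rV[R]_n -> \bar R} :=
  match n with
  | 0 => \d_(0 : 'rV[R]_0)
  | k.+1 => lebesgue_cons (lebesgue_rV k)
  end.

Lemma lebesgue_rV_box (R : realType) n (a b : 'rV[R]_n) :
  (forall j, a ord0 j <= b ord0 j) ->
  lebesgue_rV n [set x | forall j, x ord0 j \in `[a ord0 j, b ord0 j]] =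
  (\prod_(j < n) (b ord0 j - a ord0 j))%:E.
Proof.
elim: n => [|n IH] in a b * => ab.
  by rewrite big_ord0 /= diracE mem_set// => -[].
pose a' : 'rV[R]_n := \row_k a ord0 (lift ord0 k).
pose b' : 'rV[R]_n := \row_k b ord0 (lift ord0 k).
rewrite /= /lebesgue_cons /pushforward; set S := (X in (_ \x _)%E X = _).
have -> : S = `[a ord0 ord0, b ord0 ord0]%classic `*`
    [set x : 'rV[R]_n | forall k, x ord0 k \in `[a' ord0 k, b' ord0 k]].
  apply/seteqP; split=> -[r x] /=.
    move=> H; split; first by have := H ord0; rewrite mxE unlift_none.
    by move=> k; have := H (lift ord0 k); rewrite !mxE liftK.
  move=> [Hr Hx] j; rewrite mxE; have [k ->|->] := unliftP ord0 j.
    by have := Hx k; rewrite !mxE.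
  by [].
rewrite product_measure1E//; last first.
  rewrite (_ : mkset _ = \bigcap_(k in [set: 'I_n])
    ((fun x : 'rV[R]_n => x ord0 k) @^-1` `[a' ord0 k, b' ord0 k])); last first.
    by apply/seteqP; split=> x /= H k; [move=> _|]; exact: H.
  apply: fin_bigcap_measurable => // k _; rewrite -[X in measurable X]setTI.
  exact: measurable_coord.
rewrite IH; last by move=> k; rewrite !mxE.
rewrite big_ord_recl EFinM; congr (_ * _)%E; last first.
  by congr EFin; apply: eq_bigr => k _; rewrite !mxE.
apply: etrans (lebesgue_measure_itv _) _; rewrite /= lte_fin -EFinB.
have := ab ord0; rewrite le_eqVlt => /orP[/eqP->|->//].
by rewrite ltxx subrr.
Qed.

Section calculus.
Context {R : realType} {d : nat}.
Local Notation E := 'rV[R]_d.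
Implicit Types (f : E -> R) (x : E).

(* The norm of ['rV[R]_d] as a normed module is the sup norm. *)
Definition enorm x : R := Num.sqrt (\sum_j x ord0 j ^+ 2).

Definition partial (j : 'I_d) f : E -> R := fun x => 'D_(delta_mx ord0 j) f x.

Definition partials (s : seq 'I_d) f : E -> R := foldr partial f s.

Definition Ck (k : nat) f := forall s : seq 'I_d,
  ((size s <= k)%N -> continuous (partials s f)) /\
  ((size s < k)%N -> forall x j, derivable (partials s f) x (delta_mx ord0 j)).

Definition smooth f := forall k, Ck k f.

Definition laplacian f : E -> R := fun x => \sum_j partial j (partial j f) x.

Definition radial_derive f : E -> R := fun x => \sum_j x ord0 j * partial j f x.

Definition exp_decay f :=
  exists C a : R, 0 < a /\ forall x, `|f x| <= C * expR (- (a * enorm x)).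

Definition test_function f :=
  smooth f /\ compact (closure [set x | f x != 0]).

Implicit Types (u v w : E -> R[i]).

Local Notation mu := (@lebesgue_rV R d).

Definition abs2 (z : R[i]) : R := complex.Re z ^+ 2 + complex.Im z ^+ 2.

Definition cintegral u : R[i] :=
  (\int[mu]_x complex.Re (u x)) +i* (\int[mu]_x complex.Im (u x)).

Definition L2 u :=
  [/\ measurable_fun setT (fun x => complex.Re (u x)),
      measurable_fun setT (fun x => complex.Im (u x)) &
      (\int[mu]_x (abs2 (u x))%:E < +oo)%E].

Definition is_weak_partial (j : 'I_d) u w := L2 w /\
  forall phi, test_function phi ->
    cintegral (fun x => u x * (partial j phi x)%:C) =
    - cintegral (fun x => w x * (phi x)%:C).

(* A representative of the weak derivative in [L^2], and 0 if there is none. *)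
Definition weak_partial (j : 'I_d) u : E -> R[i] :=
  xget (fun=> 0) [set w | is_weak_partial j u w].

Definition H1 u := L2 u /\ forall j, exists w, is_weak_partial j u w.

Definition H2 u := H1 u /\ forall j, H1 (weak_partial j u).

Definition weak_laplacian u : E -> R[i] :=
  fun x => \sum_j weak_partial j (weak_partial j u) x.

Definition grad2 u : E -> R := fun x => \sum_j abs2 (weak_partial j u x).

Definition soliton (g : R -> R) (lambda : R) (Q : E -> R) :=
  [/\ Ck 2 Q, forall x, 0 < Q x,
      forall x y, enorm x = enorm y -> Q x = Q y,
      exp_decay Q &
      forall x, laplacian Q x - lambda * Q x + g (Q x ^+ 2) * Q x = 0].

Definition V_minus (g : R -> R) (Q : E -> R) : E -> R := fun x => g (Q x ^+ 2).

Definition V_plus (g : R -> R) (Q : E -> R) : E -> R :=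
  fun x => g (Q x ^+ 2) + 2 * derive1 g (Q x ^+ 2) * Q x ^+ 2.

Definition smooth_exp_decay f := smooth f /\ forall s, exp_decay (partials s f).

(* [- Delta + lambda - V], with domain [H2] *)
Definition schrodinger (lambda : R) (V : E -> R) u : E -> R[i] :=
  fun x => - weak_laplacian u x + (lambda - V x)%:C * u x.

(* [JL], with domain [H2 * H2]; [Vp], [Vm] are the potentials of [L_+], [L_-] *)
Definition JL (lambda : R) (Vp Vm : E -> R) (z : (E -> R[i]) * (E -> R[i])) :
    (E -> R[i]) * (E -> R[i]) :=
  (schrodinger lambda Vm z.2, fun x => - schrodinger lambda Vp z.1 x).

Definition zero_ae (z : (E -> R[i]) * (E -> R[i])) :=
  {ae mu, forall x, z.1 x = 0 /\ z.2 x = 0}.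

Definition eigenvector (lambda : R) (Vp Vm : E -> R) (k : R[i])
    (z : (E -> R[i]) * (E -> R[i])) :=
  [/\ H2 z.1, H2 z.2, ~ zero_ae z &
      {ae mu, forall x, (JL lambda Vp Vm z).1 x = k * z.1 x /\
                        (JL lambda Vp Vm z).2 x = k * z.2 x}].

(* The essential spectrum of [JL]: as the potentials decay, it is that of the
   free operator. *)
Definition JL_ess_spectrum (lambda : R) : set R[i] :=
  [set k | exists2 tau : R, lambda <= `|tau| & k = 0 +i* tau].

(* Elements of [H^1 * H^1] are represented by functions, not by classes modulo
   almost everywhere equality. *)
Definition H1_subspace (U : set ((E -> R[i]) * (E -> R[i]))) :=
  [/\ forall z, U z -> H1 z.1 /\ H1 z.2,
      U (fun=> 0, fun=> 0) &
      forall (c : R[i]) z1 z2, U z1 -> U z2 ->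
        U (fun x => c * z1.1 x + z2.1 x, fun x => c * z1.2 x + z2.2 x)].

Definition calV (V : E -> R) : E -> R := fun x => 2^-1 * radial_derive V x.

(* The quadratic form of [- Delta + calV V], [calV V] being the potential of
   half the commutator of [- Delta + lambda - V] with [d/2 + x . grad]. *)
Definition calL_form (V : E -> R) u : R :=
  \int[mu]_x (grad2 u x + calV V x * abs2 (u x)).

Definition B_form (Vp Vm : E -> R) (z : (E -> R[i]) * (E -> R[i])) : R :=
  calL_form Vp z.1 + calL_form Vm z.2.

Definition spectral_property (Vp Vm : E -> R)
    (U : set ((E -> R[i]) * (E -> R[i]))) :=
  exists2 delta0 : R, 0 < delta0 & forall z, U z -> ~ zero_ae z ->
    delta0 * \int[mu]_y ((grad2 z.1 y + grad2 z.2 y) +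
      expR (- enorm y) * (abs2 (z.1 y) + abs2 (z.2 y))) < B_form Vp Vm z.

End calculus.

(* Main.v *)
Require Import Defs.
From mathcomp Require Import all_boot all_order all_algebra.
From mathcomp Require Import all_classical all_reals all_analysis.
From mathcomp Require Import measurable_realfun.
From mathcomp Require Import complex.
From mathcomp Require Import ring lra.

Import Order.TTheory GRing.Theory Num.Theory.
Import numFieldNormedType.Exports.
Local Open Scope classical_set_scope.
Local Open Scope ring_scope.

Set Implicit Arguments.
Unset Strict Implicit.
Unset Printing Implicit Defensive.

(** Let z = (u, v) be an eigenvector of JL for i tau. Formally the commutator
    form vanishes at z: since Lambda is skew, Re <L_+ u, Lambda u> is the value of
    the form of [1/2 [L_+, Lambda]] at u, and likewise for L_- and v, so that
    B(z, z) = Re <- i tau v, Lambda u> + Re <i tau u, Lambda v>, and the two terms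
    cancel, again because Lambda is skew. The Spectral Property bounds B(z, z)
    from below, strictly, by a nonnegative number: a contradiction.

    The computation is only formal because z need not decay, so Lambda u need not
    be square integrable. The vector field x is therefore replaced, one coordinate
    at a time, by the bounded fields (sin (e x_j) / e) e_j. For those the
    computation is exact for functions in H^2, and gives
    [int cos (e x_j) |u_j|^2 + (e^2/4) cos (e x_j) |u|^2
     + (sin (e x_j) / (2 e)) V_j |u|^2] ([null_virial], where u_j and V_j are
    derivatives in direction j). As e tends to 0 the integrand converges, and it
    is dominated, because |sin (e x_j) / e| <= |x_j| and x_j V_j is bounded by
    exponential decay; the sum over j is the commutator form
    ([virial_identity]). Real and imaginary parts decouple into two real systems
    L_+ p = tau q, L_- q = tau p, so everything is done for real functions.

    What remains is integration by parts for two functions that are both only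
    weakly differentiable ([weighted_integration_by_parts]). It is obtained from
    difference quotients. A weakly differentiable function is almost everywhere
    the integral of its derivative along coordinate lines
    ([weak_deriv_line_integral]): against a product of bumps this is Fubini's
    theorem together with the fact that averaging a bump gives a bump, and
    products of bumps separate functions ([tensor_orthogonal_ae0]). Hence
    increments over t are controlled by t times the derivative, and the
    translation invariance of the integral of W f h, expanded to first order in t,
    is the formula. *)

(** * Translations of row vectors *)

Section translation.
Context {R : realType}.

Definition translate {d : nat} (j : 'I_d) (t : R) (x : 'rV[R]_d) : 'rV[R]_d :=
  x + t *: delta_mx ord0 j.

Lemma translateE d (j i : 'I_d) t (x : 'rV[R]_d) :
  translate j t x ord0 i = x ord0 i + t * (i == j)%:R.
Proof. by rewrite /translate !mxE eqxx. Qed.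

Lemma translate0 d (j : 'I_d) (x : 'rV[R]_d) : translate j 0 x = x.
Proof. by rewrite /translate scale0r addr0. Qed.

Lemma translateD d (j : 'I_d) s t (x : 'rV[R]_d) :
  translate j s (translate j t x) = translate j (t + s) x.
Proof. by rewrite /translate scalerDl addrA. Qed.

Lemma measurable_translate2 d (j : 'I_d) :
  measurable_fun setT
    (fun p : measurableTypeR R * 'rV[R]_d => translate j p.1 p.2).
Proof.
apply: measurable_fun_coordP => i.
rewrite (_ : (fun _ => _) = (fun p : measurableTypeR R * 'rV[R]_d =>
    p.2 ord0 i + p.1 * (i == j)%:R)); last first.
  by apply/funext => p; rewrite translateE.
apply: measurable_funD.
  exact: (measurableT_comp (@measurable_coord R d i) measurable_snd).
by apply: measurable_funM => //.
Qed.

Lemma measurable_translate d (j : 'I_d) t :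
  measurable_fun setT (@translate d j t).
Proof.
apply: measurable_fun_coordP => i.
rewrite (_ : (fun _ => _) = (fun x : 'rV[R]_d =>
    x ord0 i + t * (i == j)%:R)); last first.
  by apply/funext => p; rewrite translateE.
by apply: measurable_funD => //; exact: measurable_coord.
Qed.

Local Open Scope ereal_scope.

Lemma ge0_lebesgue_integral_addr (t : R) (f : R -> \bar R) :
  measurable_fun setT f -> (forall x, 0 <= f x) ->
  \int[lebesgue_measure]_x f (x + t)%R = \int[lebesgue_measure]_x f x.
Proof.
move=> mf f0.
have mT : measurable_fun setT (fun x : measurableTypeR R => (x +
  t)%R : measurableTypeR R).
  by apply: measurable_funD.
transitivity (\int[pushforward (@lebesgue_measure R)
    (fun x : measurableTypeR R => (x + t)%R : measurableTypeR R)]_x f x).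
  by rewrite ge0_integral_pushforward//= preimage_setT.
apply: eq_measure_integral => //= A mA _.
apply/esym/lebesgue_measure_unique => //= _ [[a b]] _ <-.
rewrite /pushforward (_ : _ @^-1` _ = `](a - t)%R, (b - t)%R]%classic).
  rewrite !lebesgue_measure_itv/= !lte_fin ltrD2r; case: ifP => // _.
  by rewrite -!EFinB; congr EFin; ring.
by apply/seteqP; split=> x /=; rewrite !in_itv/= ltrBlDr lerBrDr.
Qed.

(** By induction on the dimension: Tonelli's theorem isolates the factor of the
    product measure that the translation moves. *)
Lemma ge0_integral_translate d (j : 'I_d) (t : R) (f : 'rV[R]_d -> \bar R) :
  measurable_fun setT f -> (forall x, 0 <= f x) ->
  \int[lebesgue_rV d]_x f (translate j t x) = \int[lebesgue_rV d]_x f x.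
Proof.
elim: d => [|d IH] in j f *; first by case: j.
move=> mf f0.
have pushE (g : 'rV[R]_d.+1 -> \bar R) : measurable_fun setT g ->
    (forall x, 0 <= g x) ->
    \int[lebesgue_rV d.+1]_x g x =
    \int[(@lebesgue_measure R \x lebesgue_rV d)%E]_p g (rV_cons p).
  move=> mg g0.
  rewrite (_ : \int[_]_x g x = \int[pushforward
    ((@lebesgue_measure R \x lebesgue_rV d)%E) rV_cons]_x g x)//.
  by rewrite ge0_integral_pushforward//= ?preimage_setT//;
    exact: measurable_rV_cons.
have mft : measurable_fun setT (f \o translate j t).
  exact: (measurableT_comp mf (measurable_translate j t)).
rewrite pushE// pushE//.
have mfc : measurable_fun setT (fun p => f (rV_cons p)) :=
  measurableT_comp mf (@measurable_rV_cons R d).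
have mftc : measurable_fun setT (fun p => f (translate j t (rV_cons p))) :=
  measurableT_comp mft (@measurable_rV_cons R d).
have [k jk|j0] := unliftP ord0 j.
- apply: (etrans (fubini_tonelli1 _ mftc (fun=> f0 _))).
  apply: (etrans _ (esym (fubini_tonelli1 _ mfc (fun=> f0 _)))).
  apply: eq_integral => r _; rewrite /fubini_F.
  rewrite -(IH k (fun x => f (rV_cons (r, x)))) => [||//]; last first.
    apply: (measurableT_comp mfc); exact: measurable_fun_pair.
  apply: eq_integral => x _; congr f.
  apply/rowP => i; rewrite translateE !mxE/= jk.
  have [l ->|->] := unliftP ord0 i.
    by rewrite /= translateE (inj_eq lift_inj).
  by rewrite (negbTE (neq_lift _ _)) mulr0 addr0.
- apply: (etrans (fubini_tonelli2 _ mftc (fun=> f0 _))).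
  apply: (etrans _ (esym (fubini_tonelli2 _ mfc (fun=> f0 _)))).
  apply: eq_integral => x _; rewrite /fubini_G.
  rewrite -(ge0_lebesgue_integral_addr t (f :=
    fun r => f (rV_cons (r, x)))) => [||//]; last first.
    apply: (measurableT_comp mfc); exact: measurable_fun_pair.
  apply: eq_integral => r _; congr f.
  apply/rowP => i; rewrite translateE !mxE/= j0.
  have [l ->|->] := unliftP ord0 i.
    by rewrite eq_sym (negbTE (neq_lift _ _)) mulr0 addr0.
  by rewrite /= mulr1.
Qed.

End translation.

(** * Boxes generate the measurable sets *)

Section boxes.
Context {R : realType} {d : nat}.
Local Notation E := 'rV[R]_d.

Definition open_box (a b : E) : set E :=
  [set x | forall j, x ord0 j \in `]a ord0 j, b ord0 j[ ].

Lemma measurable_open_box a b : measurable (open_box a b).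
Proof.
rewrite (_ : open_box a b = \bigcap_(k in [set: 'I_d])
    ((fun x : E => x ord0 k) @^-1` `]a ord0 k, b ord0 k[)); last first.
  by apply/seteqP; split=> x /= H k; [move=> _|]; exact: H.
apply: fin_bigcap_measurable => // k _; rewrite -[X in measurable X]setTI.
exact: measurable_coord.
Qed.

Lemma open_boxI : setI_closed [set A | exists a b, A = open_box a b].
Proof.
move=> _ _ [a [b ->]] [a' [b' ->]].
exists (\row_j Num.max (a ord0 j) (a' ord0 j)),
  (\row_j Num.min (b ord0 j) (b' ord0 j)).
apply/seteqP; split=> x /=.
  move=> [H H'] j; move: (H j) (H' j);
    rewrite !in_itv/= => /andP[h1 h2] /andP[h3 h4].
  by rewrite !mxE gt_max lt_min h1 h2 h3.
by move=> H; split=> j; move: (H j); rewrite !in_itv/= !mxE gt_max lt_min =>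
  /andP[/andP[h1 h2] /andP[h3 h4]]; apply/andP.
Qed.

(** Lets the monotone-class argument start from open boxes, which products of
    bumps approximate, instead of preimages of coordinates. *)
Lemma measurable_open_boxE :
  @measurable _ E = <<s [set A | exists a b, A = open_box a b] >>.
Proof.
set G := [set A | _].
apply/seteqP; split=> A; last first.
  apply: smallest_sub; first exact: sigma_algebra_measurable.
  by move=> _ [a [b ->]]; exact: measurable_open_box.
move=> mA.
have : measurable_fun setT (fun x : g_sigma_algebraType G => x : E).
  apply: measurable_fun_coordP => j.
  apply: (measurability _ (RGenOInfty.measurableE R)) => /=.
  move=> _ [_ [a ->] <-]; rewrite setTI.
  (* The half-space x_j > a is exhausted by boxes bounded by n in every
     direction. *)
  rewrite (_ : _ @^-1` _ = \bigcup_n open_box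
    (\row_k (if k == j then a else - n%:R)) (\row_k n%:R)).
    apply: bigcupT_measurable => n.
    by apply: sub_sigma_algebra; exists (\row_k (if k == j then a else -
      n%:R)), (\row_k n%:R).
  apply/seteqP; split=> x /=; rewrite in_itv/= andbT; last first.
    by move=> [n _ /(_ j)]; rewrite in_itv/= !mxE eqxx => /andP[].
  move=> ax; exists (Num.bound (\sum_k `|x ord0 k|)) => // k.
  have xk : `|x ord0 k| < (Num.bound (\sum_k `|x ord0 k|))%:R.
    apply: le_lt_trans (archi_boundP _); last exact: sumr_ge0.
    by rewrite (bigD1 k)//= lerDl sumr_ge0.
  move: xk; rewrite ltr_norml in_itv/= !mxE => /andP[x1 ->]; rewrite andbT.
  by case: eqP => [->|].
by move=> /(_ measurableT _ mA); rewrite setTI preimage_id.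
Qed.

(** The boxes with rational centres and half-sides 1/(n + 1) form a countable
    base of the topology. *)
Lemma open_measurable_rV (A : set E) : open A -> measurable A.
Proof.
move=> oA.
pose F (p : 'rV[rat]_d * nat) : set E :=
  open_box (\row_j (ratr (p.1 ord0 j) - p.2.+1%:R^-1))
           (\row_j (ratr (p.1 ord0 j) + p.2.+1%:R^-1)).
rewrite (_ : A = \bigcup_p (if pselect (F p `<=` A) then F p else set0)).
  apply: countable_bigcupT_measurable; first exact: countableP.
  by move=> p; case: (pselect (F p `<=` A)) => /= pA //;
    exact: measurable_open_box.
apply/seteqP; split=> x; last by move=> [p _];
  case: (pselect (F p `<=` A)) => /= pA // /pA.
move=> Ax.
have /nbhs_ballP[e /= e0 xeA] := open_nbhs_nbhs (conj oA Ax).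
(* A box of half-side 1/(n + 1) that contains x has diameter less than e. *)
pose n := Num.bound (2 / e).
have ne : 2 * n.+1%:R^-1 < e.
  rewrite ltr_pdivrMr// mulrC -ltr_pdivrMr//.
  apply: (lt_le_trans (archi_boundP _)); first by rewrite divr_ge0// ltW.
  by rewrite ler_nat.
have n0 : 0 < n.+1%:R^-1 :> R by rewrite invr_gt0.
have /choice[q xq] : forall j, exists r : rat,
    ratr r \in `](x ord0 j - n.+1%:R^-1), (x ord0 j + n.+1%:R^-1)[.
  move=> j; have [|r rx] := @rat_in_itvoo R (x ord0 j - n.+1%:R^-1) (x ord0 j +
    n.+1%:R^-1).
    by rewrite ltrBlDr -addrA ltrDl addr_gt0.
  by exists r.
exists (\row_j q j, n) => //; case: (pselect (F (\row_j q j,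
  n) `<=` A)) => /= [H|].
  move=> j /=; have := xq j; rewrite !in_itv/= !mxE => /andP[q1 q2].
  by rewrite ltrBlDr q2/= -ltrBlDr.
move=> nA; exfalso; apply: nA => y Fy; apply: xeA; split => // i j.
rewrite (ord1 i); have := xq j; have := Fy j.
rewrite /ball/= !in_itv/= !mxE ltr_norml => /andP[y1 y2] /andP[q1 q2].
move: ne q1 q2 y1 y2; move: (n.+1%:R^-1) (ratr (q j)) => u v. by move=> *;
  apply/andP; split; lra.
Qed.

Lemma continuous_measurable_rV (f : E -> R) :
  continuous f -> measurable_fun setT f.
Proof.
move=> cf; apply: (measurability _ (RGenOInfty.measurableE R)) => /=.
move=> _ [_ [a ->] <-]; rewrite setTI; apply: open_measurable_rV.
by apply: open_comp => [x _|]; [exact: cf|exact: interval_open].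
Qed.

End boxes.

Section vanishing_on_boxes.
Local Open Scope ereal_scope.
Context {R : realType} {d : nat}.
Local Notation E := 'rV[R]_d.
Variables (mu : {measure set E -> \bar R}) (g : E -> \bar R).
Hypothesis ig : mu.-integrable setT g.
Hypothesis gT : \int[mu]_x g x = 0.
Hypothesis gbox : forall a b, \int[mu]_(x in open_box a b) g x = 0.

(** The measurable sets over which [g] integrates to 0 form a Dynkin system, and
    it contains the pi-system of open boxes. *)
Lemma integral_open_box_ae_eq0 : ae_eq mu setT g (cst 0).
Proof.
apply: integral_ae_eq => // A _ mA; rewrite integral0.
have igS S : measurable S -> mu.-integrable S g.
  by move=> mS; exact: (integrableS measurableT).
move: (mA); rewrite measurable_open_boxE => sA.
apply: (dynkin_induction (P := fun S => \int[mu]_(x in S) g x = 0)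
  measurable_open_boxE open_boxI) sA => //.
- by move=> _ [a [b ->]]; exact: gbox.
- move=> S mS S0; have mC := measurableC mS.
  move: gT; rewrite -(setUv S) integral_setU//=.
  + by rewrite S0 add0e.
  + by rewrite setUv; exact: (measurable_int mu).
  + by apply/disj_setPS; rewrite setICr.
- move=> F mF tF F0; rewrite integral_bigcup//.
    by rewrite eseries0// => i _ _; exact: F0.
  by apply: igS; exact: bigcupT_measurable.
Qed.

End vanishing_on_boxes.

(** * Square-integrable functions *)

Section square_integrable.
Context {R : realType} {d : nat}.
Local Notation E := 'rV[R]_d.
Local Notation mu := (lebesgue_rV (R := R) d).
Implicit Types (f g h W : E -> R).

Definition L1r f := mu.-integrable setT (EFin \o f).

Lemma L1r_measurable f : L1r f -> measurable_fun setT f.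
Proof. by move=> /(measurable_int mu) /measurable_EFinP. Qed.

Lemma L1r_le f g : measurable_fun setT f -> L1r g ->
  (forall x, `|f x| <= g x) -> L1r f.
Proof.
move=> mf ig fg; apply: (le_integrable measurableT _ _ ig).
  exact/measurable_EFinP.
by move=> x _ /=; rewrite lee_fin (le_trans (fg x))// ler_norm.
Qed.

Lemma L1rD f g : L1r f -> L1r g -> L1r (fun x => f x + g x).
Proof. by move=> F G; apply: (integrableD measurableT F G). Qed.

Lemma L1rZ c f : L1r f -> L1r (fun x => c * f x).
Proof. by move=> F; apply: (integrableZl measurableT c F). Qed.

Lemma L1rN f : L1r f -> L1r (fun x => - f x).
Proof. by move=> /(L1rZ (-1)); congr L1r; apply/funext => x;
  rewrite mulN1r. Qed.

Lemma L1rB f g : L1r f -> L1r g -> L1r (fun x => f x - g x).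
Proof. by move=> F G; apply: L1rD => //; exact: L1rN. Qed.

Lemma L1r_norm f : L1r f -> L1r (fun x => `|f x|).
Proof. by move=> F; exact: (integrable_norm F). Qed.

Lemma L1r_sum I (r : seq I) (F : I -> E -> R) :
  (forall i, L1r (F i)) -> L1r (fun x => \sum_(i <- r) F i x).
Proof.
move=> iF; elim: r => [|i r IH].
  rewrite (_ : (fun _ => _) = cst 0); first exact: (integrable0 mu setT).
  by apply/funext => x; rewrite big_nil.
rewrite (_ : (fun _ => _) = fun x => F i x + \sum_(j <- r) F j x).
  exact: L1rD.
by apply/funext => x; rewrite big_cons.
Qed.

Lemma IntD f g : L1r f -> L1r g ->
  \int[mu]_x (f x + g x) = \int[mu]_x f x + \int[mu]_x g x.
Proof. exact: RintegralD. Qed.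

Lemma IntB f g : L1r f -> L1r g ->
  \int[mu]_x (f x - g x) = \int[mu]_x f x - \int[mu]_x g x.
Proof. exact: RintegralB. Qed.

Lemma IntZ c f : L1r f -> \int[mu]_x (c * f x) = c * \int[mu]_x f x.
Proof. exact: RintegralZl. Qed.

Lemma Int0 : \int[mu]_x 0 = 0 :> R.
Proof. by rewrite /Rintegral integral0. Qed.

Lemma IntN f : L1r f -> \int[mu]_x (- f x) = - \int[mu]_x f x.
Proof.
move=> F; rewrite -mulN1r -IntZ//.
by apply: eq_Rintegral => x _; rewrite mulN1r.
Qed.

Lemma Int_sum I (r : seq I) (F : I -> E -> R) : (forall i, L1r (F i)) ->
  \int[mu]_x (\sum_(i <- r) F i x) = \sum_(i <- r) \int[mu]_x F i x.
Proof.
move=> iF; elim: r => [|i r IH].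
  rewrite big_nil -[RHS]Int0.
  by apply: eq_Rintegral => x _; rewrite big_nil.
rewrite big_cons -IH -IntD//; last exact: L1r_sum.
by apply: eq_Rintegral => x _; rewrite big_cons.
Qed.

Lemma le_Int_norm f g : L1r f -> L1r g -> (forall x, `|f x| <= g x) ->
  `|\int[mu]_x f x| <= \int[mu]_x g x.
Proof.
move=> F G fg; apply: (le_trans (le_normr_Rintegral measurableT F)).
by apply: le_Rintegral => //; exact: L1r_norm.
Qed.

Lemma eq_Int_ae f g : measurable_fun setT f -> measurable_fun setT g ->
  {ae mu, forall x, f x = g x} -> \int[mu]_x f x = \int[mu]_x g x.
Proof.
move=> mf mg fg; congr fine; apply: ae_eq_integral => //.
- exact/measurable_EFinP.
- exact/measurable_EFinP.
- by apply: filterS fg => x /= ->.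
Qed.

Lemma measurable_comp_translate f (j : 'I_d) t :
  measurable_fun setT f -> measurable_fun setT (fun x => f (translate j t x)).
Proof. move=> mf; exact: (measurableT_comp mf (measurable_translate j t)). Qed.

Lemma L1r_translate f (j : 'I_d) t :
  L1r f -> L1r (fun x => f (translate j t x)).
Proof.
move=> F; have mf := L1r_measurable F.
apply/integrableP; split.
  by apply/measurable_EFinP; exact: measurable_comp_translate.
move/integrableP: (F) => [_]; congr (_ < _)%E.
rewrite -(ge0_integral_translate j t)//.
by apply: measurableT_comp => //; exact/measurable_EFinP.
Qed.

Lemma Int_translate f (j : 'I_d) t : L1r f ->
  \int[mu]_x f (translate j t x) = \int[mu]_x f x.
Proof.
move=> F; have mf := L1r_measurable F; congr fine.
have mF : measurable_fun setT (EFin \o f) by exact/measurable_EFinP.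
rewrite integralE [RHS]integralE; congr (_ - _)%E.
- apply: etrans (ge0_integral_translate j t (measurable_funepos mF) _) => //.
  by apply: eq_integral => x _; rewrite !funeposE.
- apply: etrans (ge0_integral_translate j t (measurable_funeneg mF) _) => //.
  by apply: eq_integral => x _; rewrite !funenegE.
Qed.

Definition L2r f := measurable_fun setT f /\ L1r (fun x => f x ^+ 2).

Lemma L2r_mul f g : L2r f -> L2r g -> L1r (fun x => f x * g x).
Proof.
move=> [mf f2] [mg g2].
apply: (L1r_le (g := fun x => f x ^+ 2 + g x ^+ 2)).
- exact: measurable_funM.
- exact: L1rD.
- move=> x; rewrite normrM -[f x ^+ 2]real_normK ?num_real//.
  rewrite -[g x ^+ 2]real_normK ?num_real//.
  by move: (normr_ge0 (f x)) (normr_ge0 (g x)) => *; nra.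
Qed.

Lemma L2rD f g : L2r f -> L2r g -> L2r (fun x => f x + g x).
Proof.
move=> F G; have [[mf f2] [mg g2]] := (F, G).
split; first exact: measurable_funD.
rewrite (_ : (fun _ => _) = fun x => f x ^+ 2 + (2 * (f x * g x) + g x ^+ 2)).
  by apply: L1rD => //; apply: L1rD => //; apply: L1rZ; exact: L2r_mul.
by apply/funext => x; ring.
Qed.

Lemma L2r_bounded_mul W f C : measurable_fun setT W ->
  (forall x, `|W x| <= C) ->
  L2r f -> L2r (fun x => W x * f x).
Proof.
move=> mW WC [mf f2]; split; first exact: measurable_funM.
apply: (L1r_le (g := fun x => C ^+ 2 * f x ^+ 2)).
- by apply: measurable_funX; exact: measurable_funM.
- exact: L1rZ.
- move=> x; rewrite ger0_norm ?sqr_ge0// exprMn ler_wpM2r ?sqr_ge0//.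
  rewrite -[W x ^+ 2]real_normK ?num_real// lerXn2r ?nnegrE//.
  exact: le_trans (WC x).
Qed.

Lemma L2rZ c f : L2r f -> L2r (fun x => c * f x).
Proof. by apply: (@L2r_bounded_mul (fun=> c) f `|c|) => // x. Qed.

Lemma L2rN f : L2r f -> L2r (fun x => - f x).
Proof.
by move=> /(L2rZ (-1)); congr L2r; apply/funext => x; rewrite mulN1r.
Qed.

Lemma L2rB f g : L2r f -> L2r g -> L2r (fun x => f x - g x).
Proof. by move=> F G; apply: L2rD => //; exact: L2rN. Qed.

Lemma L2r_translate f (j : 'I_d) t :
  L2r f -> L2r (fun x => f (translate j t x)).
Proof.
move=> [mf f2]; split; first exact: measurable_comp_translate.
exact: (L1r_translate j t f2).
Qed.

Definition normL2sq f := \int[mu]_x (f x ^+ 2).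

Lemma normL2sq_ge0 f : 0 <= normL2sq f.
Proof. by apply: Rintegral_ge0 => x _; exact: sqr_ge0. Qed.

Lemma normL2sq_translate f j t : L2r f ->
  normL2sq (fun x => f (translate j t x)) = normL2sq f.
Proof. by move=> [_ f2]; exact: Int_translate. Qed.

(** The Cauchy-Schwarz inequality in arithmetic-geometric form: there is no
    square root, and such bounds add up and scale linearly. *)
Lemma Int_mul_le W f g C : measurable_fun setT W -> (forall x, `|W x| <= C) ->
  L2r f -> L2r g ->
  `|\int[mu]_x (W x * f x * g x)| <= C * (normL2sq f + normL2sq g).
Proof.
move=> mW WC F G; have [[mf f2] [mg g2]] := (F, G).
rewrite -IntD// -IntZ; last exact: L1rD.
apply: le_Int_norm => [||x].
- apply: L2r_mul => //; exact: (L2r_bounded_mul mW WC).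
- by apply: L1rZ; exact: L1rD.
- rewrite !normrM -mulrA ler_pM// ?mulr_ge0//.
  rewrite -[f x ^+ 2]real_normK ?num_real// -[g x ^+ 2]real_normK ?num_real//.
  by move: (normr_ge0 (f x)) (normr_ge0 (g x)) => *; nra.
Qed.

End square_integrable.

(** * Bumps on the line *)

Section smooth_line.
Context {R : realType}.
Implicit Types (f g : R -> R) (n k : nat).

(** Settles the differentiability of the flat functions below at the origin, the
    only point around which they are not given by a single formula. *)
Lemma is_derive_quadratic_error f (x l K : R) :
  (forall t, `|t| <= 1 -> `|f (x + t) - f x - t * l| <= K * t ^+ 2) ->
  is_derive x 1 f l.
Proof.
move=> H.
have K0 : 0 <= K.
  by have := H 1; rewrite normr1 lexx expr1n mulr1 => /(_ isT); exact: le_trans.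
have cvgl : h^-1 *: ((f \o shift x) (h *: 1) - f x) @[h --> 0^'] --> l.
  apply/cvgrPdist_le => e e0.
  near=> h.
  have h0 : h != 0 by near: h; exact: nbhs_dnbhs_neq.
  have hn : 0 < `|h| by rewrite normr_gt0.
  have h1 : `|h| < Num.min 1 (e / (K + 1)).
    by near: h; apply: dnbhs0_lt; rewrite lt_min ltr01/=; apply: divr_gt0; lra.
  move: h1; rewrite lt_min => /andP[h1 h2].
  rewrite /= [h *: 1]mulr1 [h + x]addrC.
  rewrite (_ : _ - _ = - (h^-1 * (f (x + h) - f x - h * l))); last first.
    by rewrite /GRing.scale/= [in RHS]mulrBr mulKf// opprB.
  rewrite normrN normrM normfV ler_pdivrMl//.
  apply: (le_trans (H _ (ltW h1))).
  rewrite -[h ^+ 2]real_normK ?num_real// expr2 mulrA mulrC ler_wpM2l//.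
  move: h2; rewrite ltr_pdivlMr ?ltr_wpDl// mulrDr mulr1 mulrC => h2.
  by apply: ltW; apply: le_lt_trans h2; rewrite lerDl.
apply: DeriveDef; first by apply/cvg_ex; exists l.
exact: cvg_lim cvgl.
Unshelve. all: by end_near. Qed.

Lemma is_derive_continuous f (f' : R -> R) :
  (forall x : R, is_derive x 1 f (f' x)) -> continuous f.
Proof.
move=> H x; apply: differentiable_continuous.
by apply/derivable1_diffP; have [] := H x.
Qed.

Lemma is_derive_affine f (f' k m x : R) :
  is_derive (k * x + m) 1 f f' ->
    is_derive x 1 (fun y => f (k * y + m)) (k * f').
Proof.
move=> H.
have G : is_derive x 1 (fun y : R => k * y + m) k.
  have D : is_derive x 1 ((k \*: (id : R -> R)) + cst m) (k *: 1 + 0).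
    by apply: is_deriveD.
  by apply: is_derive_eq D _; rewrite addr0 [_ *: _]mulr1.
by have := @is_derive1_comp _ f (fun y => k * y + m) x _ _ H G; rewrite mulrC.
Qed.

(** Recursive, so that stability under products and affine substitutions goes by
    induction on [n]. A function is smooth when this holds for every [n]. *)
Fixpoint nderiv n f : Prop := if n is m.+1 then
  exists f' : R -> R, (forall x : R,
    is_derive x 1 f (f' x)) /\ nderiv m f' else True.

Lemma nderivW n f : nderiv n.+1 f -> nderiv n f.
Proof.
elim: n f => [//|n IH] f [f' [ff' Sf']].
by exists f'; split => //; exact: IH.
Qed.

Lemma nderivD n f g : nderiv n f -> nderiv n g -> nderiv n (fun x => f x + g x).
Proof.
elim: n f g => [//|n IH] f g [f' [ff' Sf']] [g' [gg' Sg']].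
by exists (fun x => f' x + g' x); split; [move=> x;
  exact: is_deriveD|exact: IH].
Qed.

Lemma nderivM n f g : nderiv n f -> nderiv n g -> nderiv n (fun x => f x * g x).
Proof.
elim: n f g => [//|n IH] f g Sf Sg.
have [[f' [ff' Sf']] [g' [gg' Sg']]] := (Sf, Sg).
exists (fun x => f x * g' x + g x * f' x); split.
  by move=> x; exact: is_deriveM.
by apply: nderivD; apply: IH => //; exact: nderivW.
Qed.

Lemma nderiv_cst n (c : R) : nderiv n (cst c).
Proof.
elim: n c => [//|n IH] c; exists (cst 0); split; [move=> x;
  exact: is_derive_cst|exact: IH].
Qed.

Lemma nderivZ n (c : R) f : nderiv n f -> nderiv n (fun x => c * f x).
Proof. by move=> Sf; apply: (@nderivM n (cst c)) => //; exact: nderiv_cst. Qed.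

Lemma nderiv_affine n f (k m : R) : nderiv n f ->
  nderiv n (fun x => f (k * x + m)).
Proof.
elim: n f => [//|n IH] f [f' [ff' Sf']].
exists (fun x => k * f' (k * x + m)); split; last by apply: nderivZ; exact: IH.
by move=> x; exact: is_derive_affine.
Qed.

Lemma nderiv_derive f : (forall n, nderiv n f) ->
  (forall x : R, is_derive x 1 f ((derive1 f) x)) /\ (forall n,
    nderiv n (derive1 f)).
Proof.
move=> Sf.
have dE (f' : R -> R) : (forall x : R, is_derive x 1 f (f' x)) ->
  f' = (derive1 f).
  by move=> H; apply/funext => x; rewrite derive1E derive_val.
split; first by have [f' [+ _]] := Sf 1%N => /[dup] /dE <-.
by move=> n; have [f' [/dE <-]] := Sf n.+1.
Qed.

(** The functions y^-k e^(-c/y), extended by 0 to y <= 0. The derivative of one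
    is a linear combination of two others, which makes them all smooth. *)
Definition flat (c : R) k (y : R) : R :=
  if 0 < y then y^-1 ^+ k * expR (- (c * y^-1)) else 0.

(** The exponential of c/y exceeds the term of order k + 2 in its power series,
    which is what the two extra powers of y cost. *)
Lemma flat_le_sqr (c : R) k (y : R) : 0 < c -> 0 < y ->
  flat c k y <= (k.+2`!%:R / c ^+ k.+2) * y ^+ 2.
Proof.
move=> c0 y0; rewrite /flat y0.
have cy0 : 0 < c * y^-1 by rewrite divr_gt0.
have := expR_ge1Dxn k.+1 (ltW cy0).
move=> /(le_trans _) H.
have {}H : (c * y^-1) ^+ k.+2 / k.+2`!%:R <= expR (c * y^-1).
  by apply: H; rewrite lerDr.
have F0 : 0 < k.+2`!%:R :> R by rewrite ltr0n fact_gt0.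
have X0 : 0 < (c * y^-1) ^+ k.+2 / k.+2`!%:R by rewrite divr_gt0// exprn_gt0.
apply: (@le_trans _ _ (y^-1 ^+ k * ((c * y^-1) ^+ k.+2 / k.+2`!%:R)^-1)).
  rewrite expRN; apply: ler_wpM2l; first by rewrite exprn_ge0// invr_ge0 ltW.
  by rewrite lef_pV2 ?posrE// expR_gt0.
have y1 : y != 0 by rewrite gt_eqF.
have c1 : c != 0 by rewrite gt_eqF.
have -> : (c * y^-1) ^+ k.+2 = c ^+ k.+2 * (y ^+ k * y ^+ 2)^-1.
  by rewrite exprMn exprVn -exprD addn2.
rewrite le_eqVlt exprVn; apply/orP; left; apply/eqP.
have := expf_neq0 k y1; have := expf_neq0 k.+2 c1.
move: (y ^+ k) (c ^+ k.+2) => u v u0 v0.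
by field; rewrite u0 v0 y1 gt_eqF.
Qed.

Lemma is_derive_flat (c : R) k (x : R) : 0 < c ->
  is_derive x 1 (flat c k) (- k%:R * flat c k.+1 x + c * flat c k.+2 x).
Proof.
move=> c0; have [x0|x0|->] := ltrgt0P x.
- apply: (@near_eq_is_derive _ _ _
    (fun y : R => y^-1 ^+ k * expR (- (c * y^-1)))).
    near=> y; rewrite /flat; have -> // : 0 < y.
    by near: y; exact: lt_nbhsr.
  have V : is_derive x 1 (fun y : R => y^-1) (- x ^- 2).
    have x1 : (id : R -> R) x != 0 by rewrite gt_eqF.
    by have := is_deriveV x1 (is_derive_id x 1); rewrite [_ *: _]mulr1.
  have P : is_derive x 1 (fun y : R => y^-1 ^+ k) ((k%:R * x^-1 ^+ k.-1) *: (-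
    x ^- 2)).
    rewrite (_ : (fun y : R => y^-1 ^+ k) = (fun y : R => y^-1) ^+ k).
      exact: is_deriveX.
    by apply/funext => y; rewrite exprfctE.
  have Q : is_derive x 1 (fun y : R => expR (- (c * y^-1)))
      (expR (- (c * x^-1)) * (- (c *: (- x ^- 2)))).
    have Q0 : is_derive x 1 (- (c \*: (fun y : R => y^-1))) (- (c *: (- x ^-
      2))).
      by apply: is_deriveN; exact: is_deriveZ.
    by apply: (@is_derive1_comp _ expR (fun y : R => - (c * y^-1))); exact: Q0.
  apply: is_derive_eq (is_deriveM P Q) _.
  rewrite /flat x0 /GRing.scale/=.
  case: k {P} => [|k]; rewrite ?expr0 -?exprVn ?exprS ?expr0 /=; ring.
- apply: (@near_eq_is_derive _ _ _ (cst 0 : R -> R)).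
    near=> y; rewrite /flat ltNge ltW//.
    by near: y; exact: lt_nbhsl.
  by rewrite /flat ltNge (ltW x0)/= !mulr0 addr0; exact: is_derive_cst.
- rewrite /flat ltxx !mulr0 addr0.
  apply: (@is_derive_quadratic_error _ _ _ (k.+2`!%:R / c ^+ k.+2)) => t _.
  rewrite add0r ltxx mulr0 !subr0.
  have [t0|t0] := ltP 0 t.
    have := flat_le_sqr k c0 t0; rewrite /flat t0 => H.
    by rewrite ger0_norm// mulr_ge0 ?expR_ge0// exprn_ge0// invr_ge0 ltW.
  by rewrite normr0 mulr_ge0 ?sqr_ge0// divr_ge0// exprn_ge0// ltW.
Unshelve. all: by end_near. Qed.

Lemma nderiv_flat n (c : R) k : 0 < c -> nderiv n (flat c k).
Proof.
move=> c0; elim: n k => [//|n IH] k.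
exists (fun x => - k%:R * flat c k.+1 x + c * flat c k.+2 x); split.
  by move=> x; exact: is_derive_flat.
by apply: nderivD; apply: nderivZ.
Qed.

Definition Ccinfty f := (forall n, nderiv n f) /\
  exists M, forall y, M < `|y| -> f y = 0.

Lemma Ccinfty_is_derive f (x : R) : Ccinfty f ->
  is_derive x 1 f ((derive1 f) x).
Proof. by move=> [/nderiv_derive[]]. Qed.

Lemma Ccinfty_continuous f : Ccinfty f -> continuous f.
Proof.
by move=> bf; apply: (@is_derive_continuous _ (derive1 f)) => x;
  exact: Ccinfty_is_derive.
Qed.

Lemma Ccinfty_derive f : Ccinfty f -> Ccinfty (derive1 f).
Proof.
move=> [Sf [M fM]]; split; first by have [] := nderiv_derive Sf.
exists M => y My.
have : is_derive y 1 f 0.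
  apply: (@near_eq_is_derive _ _ _ (cst 0 : R -> R)).
  near=> z; rewrite fM//.
  by near: z; exact: (@norm_continuous _ R y _ (lt_nbhsr My)).
by move=> H; rewrite derive1E derive_val.
Unshelve. all: by end_near. Qed.

Lemma Ccinfty_bounded f : Ccinfty f -> exists C, forall y, `|f y| <= C.
Proof.
move=> bf; have [_ [M fM]] := bf.
have M0 : - `|M| <= `|M| by rewrite ge0_cp.
have cf : {within `[- `|M|, `|M|], continuous (fun y => `|f y|)}.
  apply: continuous_subspaceT => y; apply: continuous_comp;
    last exact: norm_continuous.
  exact: Ccinfty_continuous.
have [c _ fc] := EVT_max M0 cf.
exists `|f c| => y; have [yM|My] := leP `|y| `|M|.
  by apply: fc; rewrite in_itv/= -ler_norml.
by rewrite fM ?normr0//; apply: le_lt_trans My; exact: ler_norm.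
Qed.

(** As [c] decreases to 0 both factors e^(-c/y) tend to 1 where they do not
    vanish, so these bumps tend to the indicator of the interval. *)
Definition bump_fun (c a b y : R) := flat c 0 (y - a) * flat c 0 (b - y).

Lemma Ccinfty_bump c a b : 0 < c -> Ccinfty (bump_fun c a b).
Proof.
move=> c0; split.
  move=> n; apply: nderivM.
    rewrite (_ : (fun _ => _) = fun y => flat c 0 (1 * y - a)).
      by apply: (@nderiv_affine n (flat c 0)); exact: nderiv_flat.
    by apply/funext => y; rewrite mul1r.
  rewrite (_ : (fun _ => _) = fun y => flat c 0 (-1 * y + b)).
    by apply: (@nderiv_affine n (flat c 0)); exact: nderiv_flat.
  by apply/funext => y; rewrite mulN1r addrC.
exists (`|a| + `|b|) => y My; rewrite /bump_fun /flat.
case: ifP => [ay|_]; last by rewrite mul0r.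
case: ifP => [yb|_]; last by rewrite mulr0.
exfalso; move: My; rewrite ltNge => /negP; apply.
rewrite ler_norml; move: (ler_norm a) (ler_norm b) (ler_norm (- a)) (ler_norm
  (- b)).
by rewrite !normrN => *; apply/andP; split; lra.
Qed.

Lemma bump_ge0 c a b y : 0 <= bump_fun c a b y.
Proof.
have F z : 0 <= flat c 0 z.
  by rewrite /flat; case: ifP => // _; rewrite expr0 mul1r expR_ge0.
exact: mulr_ge0.
Qed.

Lemma bump_le_indic c a b y : 0 < c -> bump_fun c a b y <= (y \in `]a, b[)%:R.
Proof.
move=> c0; rewrite /bump_fun /flat in_itv/= !subr_gt0.
case: ifP => [ay|_] /=; last by rewrite mul0r.
case: ifP => [yb|_] /=; last by rewrite mulr0.
rewrite !expr0 !mul1r -expRD -expR0 ler_expR.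
by rewrite -opprD oppr_le0 addr_ge0// mulr_ge0 ?invr_ge0 ?subr_ge0// ltW.
Qed.

Lemma cvg_bump a b y :
  bump_fun n.+1%:R^-1 a b y @[n --> \oo] --> ((y \in `]a, b[)%:R : R).
Proof.
rewrite /bump_fun /flat in_itv/= !subr_gt0.
have [ay|ay] := ltP a y; last first.
  by under eq_fun do rewrite mul0r; exact: cvg_cst.
have [yb|yb] := ltP y b; last first.
  by under eq_fun do rewrite mulr0; exact: cvg_cst.
have E (z : R) : z^-1 ^+ 0 * expR (- (n.+1%:R^-1 * z^-1)) @[n --> \oo] --> (1 :
  R).
  rewrite -[X in _ --> X](_ : z^-1 ^+ 0 * expR (- (0 * z^-1)) = 1); last first.
    by rewrite mul0r oppr0 expR0 expr0 mulr1.
  apply: cvgM; first exact: cvg_cst.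
  apply: continuous_cvg; first exact: continuous_expR.
  by apply: cvgN; apply: cvgM; [exact: cvg_harmonic|exact: cvg_cst].
by have := cvgM (E (y - a)) (E (b - y)); rewrite mulr1; apply.
Qed.

End smooth_line.

Section primitive.
Context {R : realType}.
Implicit Types (f g : R -> R).
Local Notation leb := (@lebesgue_measure R).

Lemma Rintegral_derive f F (a b : R) : a < b -> continuous f ->
  (forall x : R, is_derive x 1 F (f x)) ->
  \int[leb]_(x in `[a, b]) f x = F b - F a.
Proof.
move=> ab cf dF; have cF := is_derive_continuous dF.
rewrite /Rintegral (@continuous_FTC2 _ f F)//.
- exact: continuous_subspaceT.
- split.
  + by move=> x _; have [] := dF x.
  + exact/cvg_at_right_filter/cF.
  + exact/cvg_at_left_filter/cF.
- by move=> x _; rewrite derive1E; have [_ ->] := dF x.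
Qed.

(** The integral from a point [a] to the left of the support is differentiable
    beyond [a] by the fundamental theorem of calculus, and locally zero on the
    rest of the line. *)
Lemma Ccinfty_primitive f : Ccinfty f ->
  exists F, forall x : R, is_derive x 1 F (f x).
Proof.
move=> bf; have [_ [M fM]] := bf; have cf := Ccinfty_continuous bf.
pose a := - `|M| - 1.
exists (fun y => \int[leb]_(u in `[a, y]) f u) => y.
have [ay|ya] := ltP a y.
  have yy : y < y + 1 by rewrite ltrDl.
  have fi : leb.-integrable `[a, y + 1] (EFin \o f).
    apply: continuous_compact_integrable; first exact: segment_compact.
    exact: continuous_subspaceT.
  have [d1 d2] := continuous_FTC1_closed yy fi ay (cf y).
  by apply: DeriveDef; [exact: d1|rewrite -derive1E; exact: d2].
have yM : y < - `|M| by apply: le_lt_trans ya _; rewrite /a ltrBlDr ltrDl.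
have ltM u : u < - `|M| -> M < `|u|.
  rewrite ltrNr => uM; apply: (le_lt_trans (ler_norm M)).
  by apply: (lt_le_trans uM); rewrite -normrN ler_norm.
rewrite (fM y); last exact: ltM.
apply: (@near_eq_is_derive _ _ _ (cst 0 : R -> R)).
near=> z; rewrite /= -[LHS](mul0r (fine (leb `[a, z]))) -Rintegral_cst//.
apply: eq_Rintegral => u; rewrite inE/= in_itv/= => /andP[_ uz].
rewrite fM//; apply: ltM; apply: (le_lt_trans uz).
by near: z; exact: lt_nbhsl.
Unshelve. all: by end_near. Qed.

(** A primitive of a bump need not have compact support, but the difference of
    two of its translates does. *)
Lemma Ccinfty_average f (t : R) : Ccinfty f -> 0 < t ->
  let F y := \int[leb]_(s in `[0, t]) f (y - s) in
  Ccinfty F /\ (forall y, derive1 F y = f y - f (y - t)).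
Proof.
move=> bf t0 F; have [P dP] := Ccinfty_primitive bf.
have [Sf [M fM]] := bf.
have dP' (y s : R) : is_derive s 1 (fun s => - P (-1 * s + y)) (f (y - s)).
  have H : is_derive s 1 (fun s => P (-1 * s + y)) (-1 * f (-1 * s + y)).
    exact: is_derive_affine.
  have := is_deriveN H; rewrite mulN1r opprK.
  by rewrite mulN1r addrC.
have FE : F = fun y => P y + -1 * P (1 * y + - t).
  apply/funext => y; rewrite /F.
  rewrite (@Rintegral_derive (fun s => f (y - s)) (fun s => - P (-1 * s +
    y)))//.
    by rewrite mulr0 add0r opprK mul1r !mulN1r addrC [- t + y]addrC.
  move=> s; apply: continuous_comp; last exact: Ccinfty_continuous.
  by apply: cvgB; [exact: cvg_cst|exact: cvg_id].
split.
  split.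
    have SP n : nderiv n P by case: n => // n; exists f; split.
    move=> n; rewrite FE; apply: nderivD => //; apply: nderivZ.
    by apply: (@nderiv_affine _ n P).
  exists (`|M| + t) => y My; rewrite /F.
  rewrite -[RHS](mul0r (fine (leb `[0, t]))) -Rintegral_cst//.
  apply: eq_Rintegral => s; rewrite inE/= in_itv/= => /andP[s0 st].
  rewrite fM//; apply: (le_lt_trans (ler_norm _)).
  have := ler_distD s y 0; rewrite !subr0 => H.
  by move: My; rewrite ltNge => /negP; move: H;
    rewrite (ger0_norm s0); have := lerB_dist y s; rewrite (ger0_norm s0) => *;
      lra.
move=> y; rewrite FE derive1E.
have D1 : is_derive y 1 (fun y => P (1 * y + - t)) (1 * f (1 * y + - t)).
  exact: is_derive_affine.
have := is_deriveD (dP y) (is_deriveZ (-1) D1).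
by move=> [_]; rewrite !mul1r [_ *: _]mulN1r => <-.
Qed.

End primitive.

(** * Products of bumps *)

Section tensor.
Context {R : realType} {d : nat}.
Local Notation E := 'rV[R]_d.
Local Notation mu := (lebesgue_rV (R := R) d).
Implicit Types (psi : 'I_d -> R -> R) (x : E).

(** Products of functions of one coordinate: partial derivatives and averages in
    a coordinate direction act on a single factor. *)
Definition tensor psi x : R := \prod_i psi i (x ord0 i).

Definition set_factor psi (j : 'I_d) (f : R -> R) : 'I_d -> R -> R :=
  fun i => if i == j then f else psi i.

Lemma tensor_set_factorE psi j f x : tensor (set_factor psi j f) x =
  f (x ord0 j) * \prod_(i | i != j) psi i (x ord0 i).
Proof.
rewrite /tensor (bigD1 j)//= /set_factor eqxx; congr (_ * _).
by apply: eq_bigr => i /negbTE ->.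
Qed.

Lemma tensorE psi j x : tensor psi x =
  psi j (x ord0 j) * \prod_(i | i != j) psi i (x ord0 i).
Proof. by rewrite /tensor (bigD1 j). Qed.

Lemma prod_translate psi j t x :
  \prod_(i | i != j) psi i (translate j t x ord0 i) =
  \prod_(i | i != j) psi i (x ord0 i).
Proof.
by apply: eq_bigr => i /negbTE ij; rewrite translateE ij mulr0 addr0.
Qed.

Lemma is_derive_translate (f : E -> R) j x (l : R) :
  is_derive (0 : R) 1 (fun t : R => f (translate j t x)) l ->
  is_derive x (delta_mx ord0 j) f l.
Proof.
move=> [H1 H2].
have e : (fun h : R => h^-1 *: ((f \o shift x) (h *: delta_mx ord0 j) - f x)) =
    (fun h : R => h^-1 *: (((fun t : R => f (translate j t x)) \o shift 0) (h
      *: 1) -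
       f (translate j 0 x))).
  apply/funext => h /=.
  by rewrite addr0 [h *: 1]mulr1 translate0 /translate [h *: _ + x]addrC.
by apply: DeriveDef; [rewrite /derivable e|rewrite /derive e].
Qed.

Lemma is_derive_tensor psi j x :
  (forall y : R, is_derive y 1 (psi j) (derive1 (psi j) y)) ->
  is_derive x (delta_mx ord0 j) (tensor psi) (tensor (set_factor psi j (derive1
    (psi j))) x).
Proof.
move=> dpsi; apply: is_derive_translate; rewrite tensor_set_factorE.
set c := \prod_(_ | _) _.
rewrite (_ : (fun _ => _) = fun t : R => psi j (1 * t + x ord0 j) * c).
  have D : is_derive (0 : R) 1 (fun t : R => psi j (1 * t + x ord0 j))
      (1 * derive1 (psi j) (1 * 0 + x ord0 j)).
    exact: is_derive_affine.
  have := is_deriveM D (is_derive_cst c (0 : R) 1).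
  by rewrite !mul1r add0r scaler0 add0r [_ *: _]mulrC.
apply/funext => t; rewrite (tensorE _ j) prod_translate translateE eqxx mulr1.
by rewrite mul1r addrC.
Qed.

Lemma continuous_tensor psi : (forall i, continuous (psi i)) ->
  continuous (tensor psi).
Proof.
move=> cpsi; rewrite /tensor.
elim: (index_enum _) => [|i r IH] x.
  rewrite [X in continuous_at _ X](_ : _ = (fun=> 1 : R));
    first exact: cst_continuous.
  by apply/funext => y; rewrite big_nil.
rewrite [X in continuous_at _ X](_ : _ = fun y : E =>
    psi i (y ord0 i) * \prod_(k <- r) psi k (y ord0 k)).
  have ci : {for x, continuous (fun y : E => psi i (y ord0 i))}.
    by apply: continuous_comp; [exact: coord_continuous|exact: cpsi].
  exact: cvgM ci (IH x).
by apply/funext => y; rewrite big_cons.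
Qed.

Definition Ccinfty_factors psi := forall i, Ccinfty (psi i).

Lemma Ccinfty_factors_set_factor psi j f : Ccinfty_factors psi -> Ccinfty f ->
  Ccinfty_factors (set_factor psi j f).
Proof. by move=> bpsi bf i; rewrite /set_factor; case: eqP. Qed.

Lemma partial_tensor psi j : Ccinfty_factors psi ->
  partial j (tensor psi) = tensor (set_factor psi j (derive1 (psi j))).
Proof.
move=> bpsi; apply/funext => x; rewrite /partial.
have [] := @is_derive_tensor psi j x (fun y => Ccinfty_is_derive y (bpsi j)).
by [].
Qed.

Lemma partials_tensor psi s : Ccinfty_factors psi ->
  exists2 psi', Ccinfty_factors psi' &
  partials s (tensor psi) = tensor psi'.
Proof.
move=> bpsi; elim: s => [|j s [psi' b' /= ->]]; first by exists psi.
rewrite partial_tensor//; exists (set_factor psi' j (derive1 (psi' j))) => //.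
by apply: Ccinfty_factors_set_factor => //; exact: Ccinfty_derive.
Qed.

Lemma test_function_tensor psi : Ccinfty_factors psi ->
  test_function (tensor psi).
Proof.
move=> bpsi; split.
  move=> k s; have [psi' b' ->] := partials_tensor s bpsi; split => _.
    by apply: continuous_tensor => i; exact: Ccinfty_continuous.
  by move=> x j; have [] := @is_derive_tensor psi' j x
    (fun y => Ccinfty_is_derive y (b' j)).
have /choice[M HM] : forall i, exists M, forall y, M < `|y| -> psi i y = 0.
  by move=> i; have [] := bpsi i.
pose K := [set x : E | forall i, `[- M i, M i]%classic (x ord0 i)].
have cK : compact K := rV_compact (fun i => @segment_compact R (- M i) (M i)).
apply: (subclosed_compact _ cK); first exact: closed_closure.
have /closure_id -> : closed K.
  by apply: compact_closed => //; exact: norm_hausdorff.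
apply: closure_subset => x /= Hx i.
suff : x ord0 i \in `[- M i, M i] by [].
rewrite in_itv/= -ler_norml leNgt; apply/negP => /HM xi; move/eqP: Hx; apply.
by rewrite (tensorE _ i) xi mul0r.
Qed.

Lemma measurable_tensor psi : Ccinfty_factors psi ->
  measurable_fun setT (tensor psi).
Proof.
move=> bpsi; apply: continuous_measurable_rV; apply: continuous_tensor => i.
exact: Ccinfty_continuous.
Qed.

End tensor.

(** * Products of bumps separate functions *)

Section testing.
Context {R : realType} {d : nat}.
Local Notation E := 'rV[R]_d.
Local Notation mu := (lebesgue_rV (R := R) d).
Implicit Types (psi : 'I_d -> R -> R) (x : E) (f g h G : E -> R).

Lemma Int_dominated_cvg (F : nat -> E -> R) G H :
  (forall n, measurable_fun setT (F n)) -> measurable_fun setT G ->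
  (forall x, F n x @[n --> \oo] --> G x) -> L1r H ->
  (forall n x, `|F n x| <= H x) ->
  \int[mu]_x F n x @[n --> \oo] --> \int[mu]_x G x.
Proof.
move=> mF mG FG iH FH.
have [|||||iG _ lim] := @dominated_convergence _ _ _ mu setT measurableT
  (fun n x => (F n x)%:E) (fun x => (G x)%:E) (EFin \o H).
- by move=> n; exact/measurable_EFinP.
- exact/measurable_EFinP.
- by apply: aeW => x _; apply: cvg_EFin; [exact: nearW|exact: FG].
- exact: iH.
- by apply: aeW => x n _; rewrite /= lee_fin.
apply: fine_cvg; rewrite /Rintegral fineK//.
exact: (integrable_fin_num measurableT iG).
Qed.

Definition box_indic (a b : E) x : R :=
  \prod_i (x ord0 i \in `]a ord0 i, b ord0 i[)%:R.

Lemma box_indicE a b : box_indic a b = \1_(open_box a b).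
Proof.
apply/funext => x; rewrite /box_indic indicE.
case: (boolP (x \in open_box a b)) => [|/negP]; rewrite inE => xab.
  by rewrite big1// => i _; rewrite xab.
have [i /negbTE xi] : exists i, x ord0 i \notin `]a ord0 i, b ord0 i[.
  apply: contrapT => /forallNP H; apply: xab => i.
  by apply/negPn/negP; exact: H.
by rewrite (bigD1 i)//= xi mul0r.
Qed.

Lemma L1r_box_indic a b : L1r (box_indic a b).
Proof.
have mB := measurable_open_box a b.
rewrite box_indicE; apply/integrableP; split.
  by apply/measurable_EFinP; exact: measurable_indic.
rewrite (eq_integral (fun x => (\1_(open_box a b) x)%:E)); last first.
  by move=> x _; rewrite gee0_abs// lee_fin.
rewrite integral_indic// setIT.
pose b' : E := \row_j Num.max (a ord0 j) (b ord0 j).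
apply: (@le_lt_trans _ _ (mu [set x | forall j, x ord0 j \in `[a ord0 j,
  b' ord0 j]])).
  apply: le_measure; rewrite ?inE; first exact: measurable_open_box.
    rewrite [X in measurable X](_ : _ = \bigcap_(k in [set: 'I_d])
      ((fun x : E => x ord0 k) @^-1` `[a ord0 k, b' ord0 k])); last first.
      by apply/seteqP; split=> x /= H k; [move=> _|]; exact: H.
    apply: fin_bigcap_measurable => // k _; rewrite -[X in measurable X]setTI.
    exact: measurable_coord.
  move=> x + j => /(_ j); rewrite !in_itv/= mxE => /andP[/ltW -> /ltW xb] /=.
  by rewrite le_max xb orbT.
by rewrite lebesgue_rV_box ?ltry// => j; rewrite mxE le_max lexx.
Qed.

Lemma box_indic_sqr a b x : box_indic a b x ^+ 2 = box_indic a b x.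
Proof. by rewrite box_indicE indicE; case: (_ \in _);
  rewrite ?expr1n ?expr0n. Qed.

Lemma box_indic_ge0 a b x : 0 <= box_indic a b x.
Proof. by rewrite box_indicE indicE. Qed.

Lemma L2r_box_indic a b : L2r (box_indic a b).
Proof.
split; first exact: L1r_measurable (L1r_box_indic a b).
by under eq_fun do rewrite box_indic_sqr; exact: L1r_box_indic.
Qed.

Lemma measurable_box_indic a b : measurable_fun setT (box_indic a b).
Proof. by have [] := L2r_box_indic a b. Qed.

Lemma tensor_bounded psi : Ccinfty_factors psi -> exists C a b,
  forall x, `|tensor psi x| <= C * box_indic a b x.
Proof.
move=> bpsi.
have /choice[C HC] : forall i, exists C, forall y, `|psi i y| <= C.
  by move=> i; exact: Ccinfty_bounded.
have /choice[M HM] : forall i, exists M, forall y, M < `|y| -> psi i y = 0.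
  by move=> i; have [] := bpsi i.
exists (\prod_i C i), (\row_i (- `|M i| - 1)), (\row_i (`|M i| + 1)) => x.
rewrite /tensor /box_indic -big_split/= normr_prod; apply: ler_prod => i _.
rewrite normr_ge0/= in_itv/= !mxE.
rewrite -opprD -ltr_norml; have [xM|xM] := ltP; first by rewrite mulr1.
rewrite mulr0 HM ?normr0//; apply: lt_le_trans xM.
by apply: (le_lt_trans (ler_norm _)); rewrite ltrDl.
Qed.

Lemma L2r_tensor psi : Ccinfty_factors psi -> L2r (tensor psi).
Proof.
move=> bpsi; have [C [a [b H]]] := tensor_bounded bpsi.
split; first exact: measurable_tensor.
apply: (L1r_le (g := fun x => C ^+ 2 * box_indic a b x)).
- by apply: measurable_funX; exact: measurable_tensor.
- by apply: L1rZ; exact: L1r_box_indic.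
- move=> x; rewrite ger0_norm ?sqr_ge0// -[_ ^+ 2]real_normK ?num_real//.
  by rewrite -[box_indic _ _ _]box_indic_sqr -exprMn lerXn2r ?nnegrE//
    (le_trans _ (H x)).
Qed.

Lemma L2r_locally_integrable G a b : (forall k, L2r k ->
  L1r (fun x => G x * k x)) ->
  L1r (fun x => G x * box_indic a b x).
Proof. by move=> /(_ _ (L2r_box_indic a b)). Qed.

(** By dominated convergence, along bumps that tend to the indicators of the
    sides of the box. *)
Lemma Int_tensor_box G a b : measurable_fun setT G ->
  (forall k, L2r k -> L1r (fun x => G x * k x)) ->
  (forall psi, Ccinfty_factors psi -> \int[mu]_x (G x * tensor psi x) = 0) ->
  \int[mu]_x (G x * box_indic a b x) = 0.
Proof.
move=> mG iG G0.
pose psi n (i : 'I_d) := bump_fun (n.+1%:R^-1 : R) (a ord0 i) (b ord0 i).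
have bpsi n : Ccinfty_factors (psi n) by move=> i; apply: Ccinfty_bump;
  rewrite invr_gt0.
have lim : \int[mu]_x (G x * tensor (psi n) x) @[n --> \oo] -->
    \int[mu]_x (G x * box_indic a b x).
  apply: (Int_dominated_cvg (H := fun x => `|G x * box_indic a b x|)).
  - by move=> n; apply: measurable_funM => //; exact: measurable_tensor.
  - by apply: measurable_funM => //; exact: measurable_box_indic.
  - move=> x; apply: cvgM; first exact: cvg_cst.
    rewrite /tensor /box_indic; elim: (index_enum _) => [|i r IH].
      under eq_fun do rewrite big_nil.
      by rewrite big_nil; exact: cvg_cst.
    under eq_fun do rewrite big_cons.
    by rewrite big_cons; apply: cvgM IH; exact: cvg_bump.
  - by apply: L1r_norm; exact: (iG _ (L2r_box_indic a b)).
  - move=> n x; rewrite !normrM ler_wpM2l// (ger0_norm (box_indic_ge0 _ _ _)).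
    rewrite /tensor normr_prod /box_indic; apply: ler_prod => i _.
    by rewrite normr_ge0/= ger0_norm ?bump_ge0// bump_le_indic// invr_gt0.
have E0 : (fun n => \int[mu]_x (G x * tensor (psi n) x)) = cst 0.
  by apply/funext => n; exact: G0.
rewrite E0 in lim; apply: (cvg_unique _ lim) => //.
exact: cvg_cst.
Qed.

(** The fundamental lemma of the calculus of variations, for products of bumps:
    they approximate indicators of boxes, and boxes generate the measurable
    sets. Integrability is assumed in the form in which Fubini's theorem gives
    it for line integrals. *)
Lemma tensor_orthogonal_ae0 G : measurable_fun setT G ->
  (forall k, L2r k -> L1r (fun x => G x * k x)) ->
  (forall psi, Ccinfty_factors psi -> \int[mu]_x (G x * tensor psi x) = 0) ->
  {ae mu, forall x, G x = 0}.
Proof.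
move=> mG iG G0.
have G1 a b := Int_tensor_box a b mG iG G0.
pose K n := box_indic (\row__ - n%:R) (\row__ n%:R).
have GK n : {ae mu, forall x, G x * K n x = 0}.
  have := @integral_open_box_ae_eq0 R d mu (fun x => (G x * K n x)%:E).
  have iGK := L2r_locally_integrable (\row__ - n%:R) (\row__ n%:R) iG.
  have EI g : L1r g -> \int[mu]_x g x = 0 -> (\int[mu]_x (g x)%:E = 0)%E.
    move=> ig; rewrite /Rintegral => g0.
    by rewrite -[LHS]fineK ?g0//; exact: (integrable_fin_num measurableT ig).
  case; first exact: iGK.
  - by apply: EI; [exact: iGK|exact: G1].
  - move=> a b; rewrite integral_mkcond.
    have [a' [b' E']] : exists a' b', open_box (\row__ - n%:R) (\row__ n%:R) `&`
        open_box a b = open_box a' b'.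
      by apply: open_boxI; [exists (\row__ - n%:R), (\row__ n%:R)|exists a, b].
    rewrite (_ : _ \_ _ = fun x => (G x * box_indic a' b' x)%:E).
      by apply: EI; [exact: L2r_locally_integrable|exact: G1].
    apply/funext => x; rewrite /K !box_indicE -E' indicI/= /patch.
    by rewrite [\1_(open_box a b) x]indicE; case: ifP => _ /=;
      rewrite ?mulr1 ?mulr0.
  - move=> N [mN N0 HN]; exists N; split => //;
      apply: subset_trans HN => x /= H H'.
    by apply: H; have := H' I; case.
have /ae_foralln : forall n, \forall x \ae mu, G x * K n x = 0 by exact: GK.
apply: filterS => x /= /(_ (Num.bound (\sum_k `|x ord0 k|))).
rewrite /K /box_indic big1 ?mulr1// => k _.
have xk : `|x ord0 k| < (Num.bound (\sum_k `|x ord0 k|))%:R.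
  apply: le_lt_trans (archi_boundP _); last exact: sumr_ge0.
  by rewrite (bigD1 k)//= lerDl sumr_ge0.
by move: xk; rewrite ltr_norml in_itv/= !mxE => ->.
Qed.

End testing.

(** * Integrals along a coordinate direction *)

Section averages.
Context {R : realType} {d : nat}.
Local Notation E := 'rV[R]_d.
Local Notation mu := (lebesgue_rV (R := R) d).
Local Notation leb := (@lebesgue_measure R).
Implicit Types (f h k : E -> R) (j : 'I_d) (x : E).

Definition window (t s : R) : R := \1_(`[0, t]%classic) s.

Lemma window_ge0 t s : 0 <= window t s. Proof. by rewrite /window indicE. Qed.

Lemma measurable_window t : measurable_fun setT (window t : measurableTypeR R
  -> R).
Proof. by apply: measurable_indic; exact: measurable_itv. Qed.

Lemma window_integrable t : leb.-integrable setT (EFin \o window t).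
Proof. exact: integrable_indic_itv. Qed.

Lemma Rintegral_window t (g : R -> R) :
  \int[leb]_(s in `[0, t]) g s = \int[leb]_s (window t s * g s).
Proof.
rewrite Rintegral_mkcond; apply: eq_Rintegral => s _.
by rewrite patch_indic /= mulrC.
Qed.

Lemma Int_window t : 0 <= t -> \int[leb]_s window t s = t.
Proof.
move=> t0; rewrite /Rintegral /window integral_indic;
  [|exact: measurableT|exact: measurable_itv].
rewrite setIT; have := lebesgue_measure_itv `[0, t]; rewrite /= => ->;
  rewrite lte_fin.
by move: t0; rewrite le_eqVlt => /predU1P[<-|->]; rewrite ?ltxx//= subr0.
Qed.

(** The sign [sg], in practice 1 or -1, orients the segment. The window [0, t]
    is a factor of the integrand, not the domain, so that Fubini's theorem
    applies to measures on whole spaces. *)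
Definition line_integral (t sg : R) j h x : R :=
  \int[leb]_s (window t s * h (translate j (sg * s) x)).

Definition line_pairing sg j h k s : R :=
  \int[mu]_x (h (translate j (sg * s) x) * k x).

Section fubini_average.
Variables (t sg : R) (j : 'I_d).

Let Phi h k (p : E * measurableTypeR R) : R :=
  window t p.2 * (h (translate j (sg * p.2) p.1) * k p.1).

Let mtr h : measurable_fun setT h ->
  measurable_fun setT (fun p : E * measurableTypeR R => h (translate j (sg *
    p.2) p.1)).
Proof.
move=> mh; apply: (measurableT_comp mh).
apply: (measurableT_comp (measurable_translate2 j)
  (g := fun p : E * measurableTypeR R => (sg * p.2 : measurableTypeR R, p.1))).
apply: measurable_fun_pair; last exact: measurable_fst.
by apply: measurable_funM => //; exact: measurable_snd.
Qed.

Let mchi : measurable_fun setT (fun p : E * measurableTypeR R => window t p.2).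
Proof. exact: (measurableT_comp (measurable_window t) measurable_snd). Qed.

Let mPhi h k : measurable_fun setT h -> measurable_fun setT k ->
  measurable_fun setT (Phi h k).
Proof.
move=> mh mk; apply: measurable_funM => //; apply: measurable_funM;
  first exact: mtr.
exact: (measurableT_comp mk measurable_fst).
Qed.

Let iJ h k s : L2r h -> L2r k ->
  L1r (fun x => h (translate j (sg * s) x) * k x).
Proof. by move=> H K; apply: L2r_mul => //; exact: L2r_translate. Qed.

Let JE h k s : L2r h -> L2r k ->
  (\int[mu]_x (Phi h k (x, s))%:E =
    (window t s * line_pairing sg j h k s)%:E)%E.
Proof.
move=> H K; rewrite -[LHS]fineK; last first.
  exact: (integrable_fin_num measurableT (L1rZ (window t s) (iJ s H K))).
congr EFin; exact: (IntZ (window t s) (iJ s H K)).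
Qed.

Let JabsE h k s : L2r h -> L2r k ->
  (\int[mu]_x `|(Phi h k (x, s))%:E| <= (window t s * (normL2sq h +
    normL2sq k))%:E)%E.
Proof.
move=> H K; have Js := iJ s H K.
have iP : L1r (fun x => Phi h k (x, s)) by exact: (L1rZ (window t s) Js).
rewrite -[leLHS]fineK; last first.
  exact: (integrable_fin_num measurableT (L1r_norm iP)).
have [_ h2] := L2r_translate j (sg * s) H; have [_ k2] := K.
rewrite lee_fin -(normL2sq_translate j (sg * s) H) -IntD// -IntZ;
  last exact: L1rD.
apply: le_Rintegral => //; [exact: L1r_norm iP|by apply: L1rZ; exact: L1rD|].
move=> x _; rewrite /Phi/= normrM (ger0_norm (window_ge0 t s)) ler_wpM2l
  ?window_ge0// normrM.
set a := h _; set b := k _.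
rewrite -[a ^+ 2]real_normK ?num_real// -[b ^+ 2]real_normK ?num_real//.
by move: (normr_ge0 a) (normr_ge0 b) => *; nra.
Qed.

Let iPhi h k : L2r h -> L2r k ->
  (mu \x leb)%E.-integrable setT (EFin \o Phi h k).
Proof.
move=> H K; have [[mh _] [mk _]] := (H, K).
have mP : measurable_fun setT (EFin \o Phi h k).
  by apply/measurable_EFinP; exact: mPhi.
apply/(integrable21ltyP mu leb mP).
have ic : leb.-integrable setT (EFin \o (fun s => window t s * (normL2sq h +
  normL2sq k))).
  exact: (integrableZr measurableT (normL2sq h +
    normL2sq k) (window_integrable t)).
apply: (@le_lt_trans _ _ (\int[leb]_s (window t s * (normL2sq h +
  normL2sq k))%:E)%E).
  apply: ge0_le_integral => //.
  - by move=> s _; exact: integral_ge0.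
  - apply: (measurable_fun_fubini_tonelli_G (fun p => `|(Phi h k p)%:E|%E)) =>
      //.
    exact: measurableT_comp.
  - by apply/measurable_EFinP/measurable_funM => //; exact: measurable_window.
  - by move=> s _; exact: JabsE.
by have := integrable_lty measurableT ic.
Qed.

Lemma measurable_line_integral h : measurable_fun setT h ->
  measurable_fun setT (line_integral t sg j h).
Proof.
move=> mh.
pose g (p : E * measurableTypeR R) :=
  (window t p.2 * h (translate j (sg * p.2) p.1))%:E.
have mg : measurable_fun setT g.
  by apply/measurable_EFinP; apply: measurable_funM => //; exact: mtr.
rewrite (_ : line_integral _ _ _ _ =
  fine \o (fubini_F leb g^\+%E \- fubini_F leb g^\-%E)%E).
  apply: measurableT_comp => //; apply: emeasurable_funB.
    by apply: measurable_fun_fubini_tonelli_F => //; exact: measurable_funepos.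
  by apply: measurable_fun_fubini_tonelli_F => //; exact: measurable_funeneg.
apply/funext => x; rewrite /line_integral /Rintegral integralE/=;
  congr (fine (_ - _)).
  by apply: eq_integral => s _; rewrite !funeposE.
by apply: eq_integral => s _; rewrite !funenegE.
Qed.

Let line_integralE h k : L2r h -> L2r k ->
  {ae mu, forall x, fubini_F leb (EFin \o Phi h k) x =
    (line_integral t sg j h x * k x)%:E}.
Proof.
move=> H K; have := ae_integrable1 (iPhi H K); apply: filterS => x /= ix.
rewrite /fubini_F -[LHS]fineK; last exact: (integrable_fin_num measurableT ix).
congr EFin; rewrite -[LHS]/(\int[leb]_s Phi h k (x, s)) /Phi/=.
(* Where [k] vanishes, the integrand along the line is not known to be
   integrable, but both sides are 0. *)
have [kx|kx] := eqVneq (k x) 0.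
  rewrite kx mulr0 -[RHS](mul0r (fine (leb setT))) -Rintegral_cst//.
  by apply: eq_Rintegral => s _; rewrite !mulr0.
rewrite /line_integral -RintegralZr//.
  by apply: eq_Rintegral => s _; rewrite mulrA.
have := integrableZr measurableT (k x)^-1 ix; congr (leb.-integrable _ _).
by apply/funext => s /=; rewrite /Phi/= -EFinM; congr EFin; rewrite mulrA mulfK.
Qed.

Lemma L1r_line_integral h k : L2r h -> L2r k ->
  L1r (fun x => line_integral t sg j h x * k x).
Proof.
move=> H K; have [[mh _] [mk _]] := (H, K).
have /integrableP[mF iF] := integrable_fubini_F (iPhi H K).
have mA : measurable_fun setT (fun x => line_integral t sg j h x * k x).
  by apply: measurable_funM => //; exact: measurable_line_integral.
apply/integrableP; split; first exact/measurable_EFinP.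
rewrite (@ae_eq_integral _ _ _ mu setT (abse \o fubini_F leb (EFin \o Phi h
  k)))//.
- by apply: measurableT_comp => //; exact/measurable_EFinP.
- exact: measurableT_comp.
- by apply: filterS (line_integralE H K) => x /= ->.
Qed.

(** Fubini's theorem. The integrand is integrable since the translates of [h]
    have the same norm as [h]. *)
Lemma Int_line_integral h k : L2r h -> L2r k ->
  \int[mu]_x (line_integral t sg j h x * k x) =
    \int[leb]_s (window t s * line_pairing sg j h k s).
Proof.
move=> H K; have iA := L1r_line_integral H K; congr fine.
have /integrableP[mF _] := integrable_fubini_F (iPhi H K).
rewrite (@ae_eq_integral _ _ _ mu setT (fubini_F leb (EFin \o Phi h k)))//.
- by rewrite (Fubini (iPhi H K)); apply: eq_integral => s _; exact: JE.
- exact: (measurable_int mu iA).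
- by apply: filterS (line_integralE H K) => x /= ->.
Qed.

Lemma line_pairing_integrable h k : L2r h -> L2r k ->
  leb.-integrable setT (EFin \o (fun s => window t s * line_pairing sg j h k
    s)).
Proof.
move=> H K.
have mG := measurable_fubini_G (iPhi H K).
rewrite (_ : _ \o _ = fubini_G mu (EFin \o Phi h k)); last first.
  by apply/funext => s; rewrite /fubini_G/= -JE.
apply: (le_integrable measurableT mG _
  (integrableZr measurableT (normL2sq h + normL2sq k) (window_integrable t))).
move=> s _.
have mP := measurable_int mu (L1rZ (window t s) (iJ s H K)).
apply: (le_trans (le_abse_integral mu measurableT mP)).
apply: (le_trans (JabsE s H K)).
by rewrite /= lee_fin ler_norm.
Qed.

End fubini_average.

Lemma Int_window_close (t c B : R) (J : R -> R) : 0 <= t ->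
  leb.-integrable setT (EFin \o (fun s => window t s * J s)) ->
  (forall s, 0 <= s <= t -> `|J s - c| <= B) ->
  `|\int[leb]_s (window t s * J s) - t * c| <= t * B.
Proof.
move=> t0 iJ JB; have ic a : leb.-integrable setT (EFin \o (fun s => window t s
  * a)).
  exact: (integrableZr measurableT a (window_integrable t)).
have cE a : t * a = \int[leb]_s (window t s * a).
  rewrite RintegralZr ?Int_window//; exact: window_integrable.
rewrite [t * c]cE -RintegralB//.
have iD : leb.-integrable setT (EFin \o (fun s => window t s * J s - window t s
  * c)).
  exact: (integrableB measurableT iJ (ic c)).
apply: (le_trans (le_normr_Rintegral measurableT iD)); rewrite cE.
apply: le_Rintegral => //; first exact: integrable_norm.
move=> s _; rewrite /= -mulrBr normrM (ger0_norm (window_ge0 _ _)).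
rewrite /window indicE; case: (boolP (_ \in _)); last by rewrite !mul0r.
by rewrite inE/= in_itv/= !mul1r; exact: JB.
Qed.

End averages.

(** * Weak derivatives *)

Section weak_derivative.
Context {R : realType} {d : nat}.
Local Notation E := 'rV[R]_d.
Local Notation mu := (lebesgue_rV (R := R) d).
Local Notation leb := (@lebesgue_measure R).
Implicit Types (f g h k W : E -> R) (j : 'I_d) (x : E) (psi : 'I_d -> R -> R).

(** Products of bumps are test functions enough, and unlike general ones they
    come with explicit averages in a coordinate direction. *)
Definition weak_deriv j f f' :=
  [/\ L2r f, L2r f' & forall psi, Ccinfty_factors psi ->
  \int[mu]_x (f x * partial j (tensor psi) x) =
    - \int[mu]_x (f' x * tensor psi x)].

Lemma line_integral_tensor psi j (t : R) : Ccinfty_factors psi -> 0 < t ->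
  line_integral t (-1) j (tensor psi) =
  tensor (set_factor psi j (fun y => \int[leb]_(s in `[0, t]) psi j (y - s))).
Proof.
move=> bpsi t0; apply/funext => x;
  rewrite tensor_set_factorE /line_integral -Rintegral_window -RintegralZr//.
  apply: eq_Rintegral => s _.
  by rewrite (tensorE _ j) prod_translate translateE eqxx mulr1 mulN1r.
apply: continuous_compact_integrable; first exact: segment_compact.
apply: continuous_subspaceT => s; apply: continuous_comp.
  by apply: cvgB; [exact: cvg_cst|exact: cvg_id].
exact: (Ccinfty_continuous (bpsi j)).
Qed.

Lemma partial_line_integral_tensor psi j (t : R) x : Ccinfty_factors psi ->
  0 < t ->
  partial j (line_integral t (-1) j (tensor psi)) x =
  tensor psi x - tensor psi (translate j (- t) x).
Proof.
move=> bpsi t0; have [bF dF] := Ccinfty_average (bpsi j) t0.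
rewrite line_integral_tensor// partial_tensor;
  last exact: Ccinfty_factors_set_factor.
rewrite tensor_set_factorE /set_factor eqxx dF mulrBl !(tensorE _ j)
  prod_translate.
rewrite translateE eqxx mulr1.
by congr (_ - _); congr (_ * _); apply: eq_bigr => i /negbTE ->.
Qed.

Lemma line_pairingN j h k (s : R) : L2r h -> L2r k ->
  line_pairing (-1) j h k s = line_pairing 1 j k h s.
Proof.
move=> H K; rewrite /line_pairing -(Int_translate j s).
  apply: eq_Rintegral => x _.
  by rewrite translateD mul1r mulN1r subrr translate0 mulrC.
by apply: L2r_mul => //; exact: L2r_translate.
Qed.

(** Test against a product of bumps. By Fubini's theorem the line integral can
    be taken of the bumps instead, in the opposite direction; the result is
    again a product of bumps, and its partial derivative is an increment of the
    original one. The definition of the weak derivative then applies. *)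
Lemma weak_deriv_line_integral j f f' (t : R) : weak_deriv j f f' -> 0 < t ->
  {ae mu, forall x, f (translate j t x) - f x - line_integral t 1 j f' x = 0}.
Proof.
move=> [F F' ff'] t0; have Ft := L2r_translate j t F.
have [[mf _] [mf' _]] := (F, F').
apply: tensor_orthogonal_ae0.
- apply: measurable_funB; last exact: measurable_line_integral.
  by apply: measurable_funB => //; exact: (measurable_comp_translate j t mf).
- move=> k K; under eq_fun do rewrite mulrBl.
  by apply: L1rB; [exact: (L2r_mul (L2rB Ft F) K)|exact: L1r_line_integral].
- move=> psi bpsi; have T := L2r_tensor bpsi.
  under eq_Rintegral do rewrite mulrBl.
  rewrite IntB; [|exact: (L2r_mul (L2rB Ft F) T)|exact: L1r_line_integral].
  rewrite Int_line_integral//.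
  under [X in _ - X]eq_Rintegral do rewrite -line_pairingN//.
  rewrite -Int_line_integral//.
  have bF := @Ccinfty_factors_set_factor _ _ psi j _ bpsi (Ccinfty_average
    (bpsi j) t0).1.
  have -> : \int[mu]_x (line_integral t (-1) j (tensor psi) x * f' x) =
      - \int[mu]_x (f x * partial j (line_integral t (-1) j (tensor psi)) x).
    rewrite line_integral_tensor// ff'// opprK.
    by apply: eq_Rintegral => x _; rewrite mulrC.
  rewrite opprK.
  under [X in _ + X]eq_Rintegral do rewrite partial_line_integral_tensor//
    mulrBr.
  rewrite IntB; [|exact: L2r_mul|by apply: L2r_mul => //; exact: L2r_translate].
  rewrite -[X in _ - X](Int_translate j t); last first.
    by apply: L2r_mul => //; exact: L2r_translate.
  under [X in _ - X]eq_Rintegral do rewrite translateD subrr translate0.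
  under eq_Rintegral do rewrite mulrBl.
  rewrite IntB; [|exact: L2r_mul|exact: L2r_mul].
  by ring.
Qed.

Lemma weak_deriv_increment j f f' k (t : R) : weak_deriv j f f' -> L2r k ->
  0 < t ->
  \int[mu]_x ((f (translate j t x) - f x) * k x) =
  \int[leb]_s (window t s * line_pairing 1 j f' k s).
Proof.
move=> ff' K t0; have [F F' _] := ff'.
have Ft := L2r_translate j t F; rewrite -Int_line_integral//; apply: eq_Int_ae.
- exact: L1r_measurable (L2r_mul (L2rB Ft F) K).
- exact: L1r_measurable (L1r_line_integral _ _ _ F' K).
- apply: filterS (weak_deriv_line_integral ff' t0) => x /= /eqP.
  by rewrite subr_eq0 => /eqP ->.
Qed.

(** For t > 0 the increment is a line integral; t < 0 is reduced to that by a
    translation. *)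
Lemma weak_deriv_increment_le j f f' k (t : R) : weak_deriv j f f' -> L2r k ->
  `|\int[mu]_x ((f (translate j t x) - f x) * k x)| <=
  `|t| * (normL2sq f' + normL2sq k).
Proof.
have pos g g' l (s : R) : weak_deriv j g g' -> L2r l -> 0 < s ->
    `|\int[mu]_x ((g (translate j s x) - g x) * l x)| <=
    s * (normL2sq g' + normL2sq l).
  move=> gg' L s0; have [_ G' _] := gg'.
  rewrite (weak_deriv_increment gg' L s0) -[X in `|X|]subr0 -(mulr0 s).
  apply: Int_window_close; [exact: ltW|exact: line_pairing_integrable|].
  move=> u _; rewrite subr0 /line_pairing mul1r.
  have G'u := L2r_translate j u G'.
  have m1 : measurable_fun [set: E] (fun=> 1 : R) by exact: measurable_cst.
  have n1 (x : E) : `|1 : R| <= 1 by rewrite normr1.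
  have := @Int_mul_le _ _ (fun=> 1) _ l 1 m1 n1 G'u L.
  rewrite normL2sq_translate// mul1r.
  by under eq_Rintegral do rewrite mul1r.
move=> ff' K; have [t0|t0|->] := ltrgt0P t.
- exact: pos.
- have [F F' _] := ff'; have Ft := L2r_translate j t F.
  have Kt := L2r_translate j (- t) K.
  rewrite -(Int_translate j (- t)); last exact: (L2r_mul (L2rB Ft F) K).
  rewrite -(normL2sq_translate j (- t) K).
  have := @pos f f' (fun x => k (translate j (- t) x)) (- t) ff' Kt.
  rewrite oppr_gt0 => /(_ t0); apply: le_trans.
  rewrite -normrN -IntN; last first.
    exact: (L1r_translate j (- t) (L2r_mul (L2rB Ft F) K)).
  rewrite le_eqVlt; apply/orP; left; apply/eqP; congr (`|_|).
  by apply: eq_Rintegral => x _;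
    rewrite translateD addNr translate0 -mulNr opprB.
- rewrite mul0r; under eq_Rintegral do rewrite translate0 subrr mul0r.
  by rewrite Int0 normr0.
Qed.

End weak_derivative.

(** * Integration by parts *)

Section integration_by_parts.
Context {R : realType} {d : nat}.
Local Notation E := 'rV[R]_d.
Local Notation mu := (lebesgue_rV (R := R) d).
Local Notation leb := (@lebesgue_measure R).
Implicit Types (f g h k W : E -> R) (j : 'I_d) (x : E).

(** Multipliers with a derivative in direction [j] and a second-order Taylor
    remainder that is uniform in [x], as a first-order expansion under the
    integral sign requires. *)
Definition weight j W W' := [/\ measurable_fun setT W, measurable_fun setT W' &
  exists C, [/\ forall x, `|W x| <= C, forall x, `|W' x| <= C &
  forall x (t : R), `|t| <= 1 ->
    `|W (translate j t x) - W x - t * W' x| <= C * t ^+ 2]].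

Lemma normL2sq_bounded_mul W f C : measurable_fun setT W ->
  (forall x, `|W x| <= C) -> L2r f ->
  normL2sq (fun x => W x * f x) <= C ^+ 2 * normL2sq f.
Proof.
move=> mW WC F; have [_ f2] := F; rewrite -IntZ//; apply: le_Rintegral => //.
- by have [] := L2r_bounded_mul mW WC F.
- exact: L1rZ.
- move=> x _; rewrite exprMn ler_wpM2r ?sqr_ge0//.
  rewrite -[W x ^+ 2]real_normK ?num_real// lerXn2r ?nnegrE//.
  exact: le_trans (WC x).
Qed.

Lemma weight_lipschitz j W C W' : (forall x, `|W' x| <= C) ->
  (forall x (t : R), `|t| <= 1 ->
    `|W (translate j t x) - W x - t * W' x| <= C * t ^+ 2) ->
  forall x (t : R), `|t| <= 1 -> `|W (translate j t x) - W x| <= 2 * C * `|t|.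
Proof.
move=> W'C WW' x t t1; rewrite -[_ - _](subrK (t * W' x)).
apply: (le_trans (ler_normD _ _)).
have C0 : 0 <= C by exact: le_trans (W'C x).
have -> : 2 * C * `|t| = C * `|t| + C * `|t| by ring.
apply: lerD.
  apply: (le_trans (WW' _ _ t1)); rewrite ler_wpM2l//.
  by rewrite -[t ^+ 2]real_normK ?num_real// expr2 ler_piMl.
by rewrite normrM mulrC ler_wpM2r.
Qed.

(** Continuity of translations, at linear rate, on products. The variation of W
    f h calls for two cases: r = t - s for the increment of f, and r = - s for
    that of h. *)
Lemma translated_weighted_close j W C g h h' (s r : R) :
  measurable_fun setT W -> (forall x, `|W x| <= C) ->
  (forall x (t : R), `|t| <= 1 ->
    `|W (translate j t x) - W x| <= 2 * C * `|t|) ->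
  L2r g -> weak_deriv j h h' -> `|s| <= 1 ->
  `|\int[mu]_x (g (translate j s x) * (W x * h (translate j (s + r) x))) -
    \int[mu]_x (W x * g x * h x)| <=
  `|r| * (normL2sq h' + C ^+ 2 * normL2sq g) +
  2 * C * `|s| * (normL2sq g + normL2sq h).
Proof.
move=> mW WC lipW G hh' s1; have [H H' _] := hh'.
have Gs := L2r_translate j s G; have Hsr := L2r_translate j (s + r) H.
have Hr := L2r_translate j r H.
have mWs := measurable_comp_translate j (- s) mW.
have WsC x : `|W (translate j (- s) x)| <= C by [].
have WsG := L2r_bounded_mul mWs WsC G.
rewrite -(Int_translate j (- s)); last first.
  by apply: L2r_mul => //; exact: L2r_bounded_mul WC Hsr.
have -> : \int[mu]_x (g (translate j s (translate j (- s) x)) *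
   (W (translate j (- s) x) * h (translate j (s + r) (translate j (- s) x)))) =
  \int[mu]_x ((h (translate j r x) - h x) * (W (translate j (- s) x) * g x)) +
  \int[mu]_x ((W (translate j (- s) x) - W x) * g x * h x) +
  \int[mu]_x (W x * g x * h x).
  have i1 : L1r (fun x => (h (translate j r x) - h x) * (W (translate j (- s)
    x) * g x)).
    by apply: L2r_mul => //; exact: L2rB.
  have i3 : L1r (fun x => W x * g x * h x).
    by apply: L2r_mul => //; exact: L2r_bounded_mul WC G.
  have i2 : L1r (fun x => (W (translate j (- s) x) - W x) * g x * h x).
    under eq_fun do rewrite !mulrBl; apply: L1rB => //; exact: L2r_mul.
  rewrite -IntD// -IntD//; last exact: L1rD.
  apply: eq_Rintegral => x _; rewrite !translateD addNr translate0.
  by rewrite addrA addNr add0r; ring.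
rewrite addrK; apply: (le_trans (ler_normD _ _)); apply: lerD.
  apply: (le_trans (weak_deriv_increment_le r hh' WsG)).
  rewrite ler_wpM2l// lerD2l.
  exact: (@normL2sq_bounded_mul (fun x => W (translate j (- s) x)) g C).
apply: Int_mul_le => //; first exact: measurable_funB.
by move=> x; have := lipW x (- s); rewrite normrN => /(_ s1).
Qed.

(** The integral of W f h does not change under a translation by t, and its
    first-order variation is t times the sum below, up to O(t^2). *)
Lemma weighted_integration_by_parts j W W' f f' h h' :
  weight j W W' -> weak_deriv j f f' -> weak_deriv j h h' ->
  \int[mu]_x (W' x * f x * h x) + \int[mu]_x (W x * f' x * h x) +
  \int[mu]_x (W x * f x * h' x) = 0.
Proof.
move=> [mW mW' [C [WC W'C WW']]] ff' hh'.
have [F F' _] := ff'; have [H H' _] := hh'.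
have lipW := weight_lipschitz W'C WW'.
have C0 : 0 <= C by exact: le_trans (WC 0).
set c1 := \int[mu]_x _; set c2 := (X in _ + X + _); set c3 := (X in _ + _ + X).
pose B2 := normL2sq h' + C ^+ 2 * normL2sq f' + 2 * C * (normL2sq f' +
  normL2sq h).
pose B3 := normL2sq f' + C ^+ 2 * normL2sq h' + 2 * C * (normL2sq h' +
  normL2sq f).
pose B1 := C * (normL2sq f + normL2sq h).
have key (t : R) : 0 < t -> t <= 1 ->
  t * `|c1 + c2 + c3| <= t * (t * (B1 + B2 + B3)).
  move=> t0 t1; have nt : `|t| = t by rewrite gtr0_norm.
  have Ft := L2r_translate j t F; have Ht := L2r_translate j t H.
  have mWt := measurable_comp_translate j t mW.
  have WtC x : `|W (translate j t x)| <= C by [].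
  (* The increments of W, f and h, respectively; the translated factors make
     their sum telescope. *)
  pose T1 := \int[mu]_x ((W (translate j t x) - W x) * f (translate j t x) * h
    (translate j t x)).
  pose T2 := \int[mu]_x ((f (translate j t x) - f x) * (W x * h (translate j t
    x))).
  pose T3 := \int[mu]_x ((h (translate j t x) - h x) * (W x * f x)).
  have i2 : L1r (fun x => (f (translate j t x) - f x) * (W x * h (translate j t
    x))).
    by apply: L2r_mul; [exact: L2rB|exact: L2r_bounded_mul WC Ht].
  have i3 : L1r (fun x => (h (translate j t x) - h x) * (W x * f x)).
    by apply: L2r_mul; [exact: L2rB|exact: L2r_bounded_mul WC F].
  have iW : L1r (fun x => W x * f x * h x).
    by apply: L2r_mul => //; exact: L2r_bounded_mul WC F.
  have i1 : L1r (fun x => (W (translate j t x) - W x) * f (translate j t x) * h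
    (translate j t x)).
    under eq_fun do rewrite !mulrBl; apply: L1rB; apply: L2r_mul => //.
      exact: (L2r_bounded_mul mWt WtC Ft).
    exact: L2r_bounded_mul WC Ft.
  have T0 : T1 + T2 + T3 = 0.
    rewrite /T1 /T2 /T3 -IntD// -IntD//; last exact: L1rD.
    rewrite -[RHS](subrr (\int[mu]_x (W x * f x * h x))).
    rewrite -[X in _ = X - _](Int_translate j t iW) -IntB//;
      last exact: L1r_translate iW.
    by apply: eq_Rintegral => x _; ring.
  have E1 : `|T1 - t * c1| <= t * (t * B1).
    have -> : T1 = - \int[mu]_x ((W (translate j (- t) x) - W x) * f x * h x).
      rewrite /T1 -(Int_translate j (- t) i1) -IntN; last first.
        under eq_fun do rewrite !mulrBl; apply: L1rB => //.
        apply: L2r_mul => //.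
        exact: (@L2r_bounded_mul _ _ (fun x => W (translate j (- t) x)) f C
          (measurable_comp_translate j (- t) mW)).
      by apply: eq_Rintegral => x _; rewrite translateD addNr translate0; ring.
    have iD : L1r (fun x => (W (translate j (- t) x) - W x) * f x * h x).
      under eq_fun do rewrite !mulrBl; apply: L1rB => //.
      apply: L2r_mul => //.
      exact: (@L2r_bounded_mul _ _ (fun x => W (translate j (- t) x)) f C
        (measurable_comp_translate j (- t) mW)).
    have iW' : L1r (fun x => W' x * f x * h x).
      by apply: L2r_mul => //; exact: L2r_bounded_mul W'C F.
    rewrite -opprD normrN /c1 -IntZ// -IntD//; last exact: L1rZ.
    have -> : t * (t * B1) = (C * t ^+ 2) * (normL2sq f + normL2sq h).
      by rewrite /B1; ring.
    rewrite (_ : \int[mu]_x _ = \int[mu]_x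
      ((W (translate j (- t) x) - W x - - t * W' x) * f x * h x)); last first.
      by apply: eq_Rintegral => x _; ring.
    apply: Int_mul_le => //.
      apply: measurable_funB; last exact: measurable_funM.
      by apply: measurable_funB => //;
        exact: (measurable_comp_translate j (- t) mW).
    by move=> x; rewrite -[t ^+ 2]sqrrN; apply: WW'; rewrite normrN nt.
  have E2 : `|T2 - t * c2| <= t * (t * B2).
    have WHt := L2r_bounded_mul mW WC Ht.
    rewrite /T2 (weak_deriv_increment ff' WHt t0); apply: Int_window_close;
      first exact: ltW.
      exact: line_pairing_integrable.
    move=> s /andP[s0 st]; have ns : `|s| = s by rewrite ger0_norm.
    have s1 : `|s| <= 1 by rewrite ns (le_trans st).
    have := translated_weighted_close (t - s) mW WC lipW F' hh' s1.
    rewrite [s + (t - s)]addrC subrK /line_pairing mul1r => /le_trans; apply.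
    rewrite ns ger0_norm ?subr_ge0// /B2 [X in _ <= X]mulrDr; apply: lerD.
      by rewrite ler_wpM2r ?addr_ge0 ?mulr_ge0 ?normL2sq_ge0 ?sqr_ge0// gerBl.
    rewrite [2 * C * s]mulrC -[s * _ * _]mulrA ler_wpM2r//.
    by rewrite mulr_ge0 ?addr_ge0 ?normL2sq_ge0 ?mulr_ge0.
  have E3 : `|T3 - t * c3| <= t * (t * B3).
    have WF := L2r_bounded_mul mW WC F.
    rewrite /T3 (weak_deriv_increment hh' WF t0); apply: Int_window_close;
      first exact: ltW.
      exact: line_pairing_integrable.
    move=> s /andP[s0 st]; have ns : `|s| = s by rewrite ger0_norm.
    have s1 : `|s| <= 1 by rewrite ns (le_trans st).
    have := translated_weighted_close (- s) mW WC lipW H' ff' s1.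
    rewrite subrr /line_pairing mul1r.
    under eq_Rintegral do rewrite translate0.
    rewrite [X in `|_ - X|](_ : _ = c3); last first.
      by apply: eq_Rintegral => x _; ring.
    move=> /le_trans; apply.
    rewrite normrN ns /B3 [X in _ <= X]mulrDr; apply: lerD.
      by rewrite ler_wpM2r ?addr_ge0 ?mulr_ge0 ?normL2sq_ge0 ?sqr_ge0.
    rewrite [2 * C * s]mulrC -[s * _ * _]mulrA ler_wpM2r//.
    by rewrite mulr_ge0 ?addr_ge0 ?normL2sq_ge0 ?mulr_ge0.
  rewrite -[X in X * _ <= _]nt -normrM.
  have -> : t * (c1 + c2 + c3) =
    - ((T1 - t * c1) + (T2 - t * c2) + (T3 - t * c3)).
    by rewrite -[LHS]subr0 -T0; ring.
  have -> : t * (t * (B1 + B2 + B3)) =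
    t * (t * B1) + t * (t * B2) + t * (t * B3).
    by ring.
  rewrite normrN.
  apply: (le_trans (ler_normD _ _)); apply: lerD => //.
  by apply: (le_trans (ler_normD _ _)); apply: lerD.
apply/eqP; rewrite -normr_le0; apply/ler_addgt0Pl => e e0; rewrite addr0.
set B := B1 + B2 + B3 in key.
have B0 : 0 <= B.
  by have := key 1 ltr01 (lexx _); rewrite !mul1r; exact: le_trans.
(* The sum is at most t B for all t in ]0, 1]. *)
pose t := Num.min 1 (e / (B + 1)).
have t0 : 0 < t by rewrite lt_min ltr01 divr_gt0// ltr_wpDl.
have t1 : t <= 1 by rewrite ge_min lexx.
have := key t t0 t1; rewrite ler_pM2l// => /le_trans; apply.
apply: (@le_trans _ _ (e / (B + 1) * B)).
  by rewrite ler_wpM2r// ge_min lexx orbT.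
by rewrite mulrAC ler_pdivrMr ?ltr_wpDl// ler_pM2l// lerDl.
Qed.

End integration_by_parts.

Section null_integrals.
Context {R : realType} {d : nat}.
Local Notation E := 'rV[R]_d.
Local Notation mu := (lebesgue_rV (R := R) d).
Implicit Types (f g h F G : E -> R) (x : E).

(** Identities between integrals are proved by writing the difference of the
    integrands as a combination of exact derivatives; integrability is carried
    along, since linearity of the integral needs it. *)
Definition null_integral F := L1r F /\ \int[mu]_x F x = 0.

Lemma null_integralD F G : null_integral F -> null_integral G ->
  null_integral (fun x => F x + G x).
Proof. by move=> [iF F0] [iG G0]; split;
  [exact: L1rD|rewrite IntD// F0 G0 addr0]. Qed.

Lemma null_integralZ c F : null_integral F -> null_integral (fun x => c * F x).
Proof. by move=> [iF F0]; split; [exact: L1rZ|rewrite IntZ// F0 mulr0]. Qed.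

Lemma null_sum I (r : seq I) (F : I -> E ->
  R) : (forall i, null_integral (F i)) ->
  null_integral (fun x => \sum_(i <- r) F i x).
Proof.
move=> nF; split; first by apply: L1r_sum => i; have [] := nF i.
rewrite Int_sum; last by move=> i; have [] := nF i.
by rewrite big1// => i _; have [] := nF i.
Qed.

Lemma null_ae F G : null_integral F -> measurable_fun setT G ->
  {ae mu, forall x, F x = G x} -> null_integral G.
Proof.
move=> [iF F0] mG FG; have mF := L1r_measurable iF; split; last first.
  by rewrite -(eq_Int_ae mF mG FG).
move/integrableP : iF => [_ iF]; apply/integrableP; split;
  first exact/measurable_EFinP.
rewrite (@ae_eq_integral _ _ _ mu setT (abse \o (EFin \o F)))//.
- by apply: measurableT_comp => //; exact/measurable_EFinP.
- by apply: measurableT_comp => //; exact/measurable_EFinP.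
- by apply: filterS FG => x /= ->.
Qed.

(** The integrand is the derivative of W f h. *)
Lemma null_by_parts j W W' f f' h h' :
  weight j W W' -> weak_deriv j f f' -> weak_deriv j h h' ->
  null_integral (fun x => W' x * f x * h x + W x * f' x * h x +
    W x * f x * h' x).
Proof.
move=> wW ff' hh'; have [mW mW' [C [WC W'C _]]] := wW.
have [F F' _] := ff'; have [H H' _] := hh'.
have i1 : L1r (fun x => W' x * f x * h x).
  by apply: L2r_mul => //; exact: L2r_bounded_mul W'C F.
have i2 : L1r (fun x => W x * f' x * h x).
  by apply: L2r_mul => //; exact: L2r_bounded_mul WC F'.
have i3 : L1r (fun x => W x * f x * h' x).
  by apply: L2r_mul => //; exact: L2r_bounded_mul WC F.
split; first by apply: L1rD => //; exact: L1rD.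
rewrite IntD//; last exact: L1rD.
by rewrite IntD//; exact: weighted_integration_by_parts wW ff' hh'.
Qed.

End null_integrals.

(** * Weights *)

Section weights.
Context {R : realType} {d : nat}.
Local Notation E := 'rV[R]_d.
Implicit Types (f g h W V : E -> R) (j k : 'I_d) (x : E).

Lemma norm_increment_le (phi phi' : R -> R) (K t : R) :
  (forall s : R, is_derive s 1 phi (phi' s)) ->
  (forall s, `|s| <= `|t| -> `|phi' s| <= K) ->
  `|phi t - phi 0| <= K * `|t|.
Proof.
move=> dphi phiK.
have cphi := is_derive_continuous dphi.
have [t0|t0] := leP 0 t.
  have [c] := MVT_segment t0 (fun s _ => dphi s) (continuous_subspaceT cphi).
  rewrite in_itv/= => /andP[c0 ct] ->; rewrite subr0 normrM ler_wpM2r//.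
  by apply: phiK; rewrite !ger0_norm.
have [c] := MVT_segment (ltW t0) (fun s _ => dphi s) (continuous_subspaceT
  cphi).
rewrite in_itv/= => /andP[c0 ct] E;
  rewrite distrC E sub0r normrM normrN ler_wpM2r//.
by apply: phiK; rewrite !ler0_norm ?lerN2// ltW.
Qed.

(** Taylor's formula, by two applications of the mean value inequality. *)
Lemma weight_C2 j W W' W'' C : measurable_fun setT W ->
  measurable_fun setT W' ->
  (forall x (t : R), is_derive t 1 (fun s : R => W (translate j s x)) (W'
    (translate j t x))) ->
  (forall x (t : R), is_derive t 1 (fun s : R => W' (translate j s x)) (W''
    (translate j t x))) ->
  (forall x, `|W x| <= C) -> (forall x, `|W' x| <= C) ->
    (forall x, `|W'' x| <= C) ->
  weight j W W'.
Proof.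
move=> mW mW' dW dW' WC W'C W''C; split => //; exists C; split => // x t _.
have L s : `|W' (translate j s x) - W' x| <= C * `|s|.
  have := @norm_increment_le (fun s => W' (translate j s x))
    (fun s => W'' (translate j s x)) C s (dW' x) (fun s _ => W''C _).
  by rewrite translate0.
pose phi s := W (translate j s x) - s * W' x.
have dphi (s : R) : is_derive s 1 phi (W' (translate j s x) - W' x).
  have D : is_derive s 1 (fun s : R => s * W' x) (W' x).
    have := is_deriveM (is_derive_id s 1) (is_derive_cst (W' x) s 1).
    by rewrite scaler0 add0r [_ *: _]mulr1.
  exact: is_deriveB (dW x s) D.
have := @norm_increment_le phi _ (C * `|t|) t dphi.
rewrite {1 2}/phi translate0 mul0r subr0 addrAC -mulrA -expr2 real_normK
  ?num_real//.
apply=> s st; apply: (le_trans (L s)); rewrite ler_wpM2l//.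
exact: le_trans (WC x).
Qed.

Lemma weightM j W W' V V' : weight j W W' -> weight j V V' ->
  weight j (fun x => W x * V x) (fun x => W' x * V x + W x * V' x).
Proof.
move=> [mW mW' [C [WC W'C WW']]] [mV mV' [D [VD V'D VV']]].
have C0 : 0 <= C by exact: le_trans (WC 0).
have D0 : 0 <= D by exact: le_trans (VD 0).
have CD0 : 0 <= C * D by exact: mulr_ge0.
split; first exact: measurable_funM.
  by apply: measurable_funD; exact: measurable_funM.
exists (4 * (C * D)); split.
- by move=> x; rewrite normrM (le_trans (ler_pM _ _ (WC x) (VD x)))//; lra.
- move=> x; apply: (le_trans (ler_normD _ _)); rewrite !normrM.
  have := ler_pM (normr_ge0 _) (normr_ge0 _) (W'C x) (VD x).
  have := ler_pM (normr_ge0 _) (normr_ge0 _) (WC x) (V'D x).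
  by move=> *; lra.
- move=> x t t1.
  have lipV := weight_lipschitz V'D VV' x t1.
  have -> : W (translate j t x) * V (translate j t x) - W x * V x -
      t * (W' x * V x + W x * V' x) =
    (W (translate j t x) - W x - t * W' x) * V (translate j t x) +
    W x * (V (translate j t x) - V x - t * V' x) +
    t * W' x * (V (translate j t x) - V x) by ring.
  have t2 : `|t| * `|t| = t ^+ 2 by rewrite -expr2 real_normK ?num_real.
  have -> : 4 * (C * D) * t ^+ 2 = C * t ^+ 2 * D + C * (D * t ^+ 2) +
     `|t| * C * (2 * D * `|t|) by rewrite -t2; ring.
  apply: (le_trans (ler_normD _ _)); apply: lerD; last first.
    by rewrite !normrM ler_pM// ?mulr_ge0// ler_wpM2l.
  apply: (le_trans (ler_normD _ _)); apply: lerD; rewrite normrM ler_pM//.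
    exact: WW'.
  exact: VV'.
Qed.

Lemma measurable_derivable_coord j (u u' : R -> R) :
  (forall y : R, is_derive y 1 u (u' y)) ->
  measurable_fun setT (fun x : E => u (x ord0 j)).
Proof.
move=> du; apply: (measurableT_comp _ (@measurable_coord R d j)).
exact: continuous_measurable_fun (is_derive_continuous du).
Qed.

Lemma weight_coord j (phi phi' phi'' : R -> R) C :
  (forall y : R, is_derive y 1 phi (phi' y)) ->
  (forall y : R, is_derive y 1 phi' (phi'' y)) ->
  (forall y, `|phi y| <= C) -> (forall y, `|phi' y| <= C) ->
  (forall y, `|phi'' y| <= C) ->
  weight j (fun x : E => phi (x ord0 j)) (fun x => phi' (x ord0 j)).
Proof.
move=> dphi dphi' b0 b1 b2.
have dc (u u' : R -> R) x (t : R) : (forall y : R, is_derive y 1 u (u' y)) ->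
    is_derive t 1 (fun s : R => u (translate j s x ord0 j)) (u' (translate j t
      x ord0 j)).
  move=> du; have := is_derive_affine (du (1 * t + x ord0 j)).
  rewrite !mul1r translateE eqxx mulr1 addrC; congr is_derive.
  by apply/funext => s; rewrite translateE eqxx mulr1 mul1r addrC.
apply: (@weight_C2 _ _ _ (fun x => phi'' (x ord0 j)) C) => //.
- exact: measurable_derivable_coord dphi.
- exact: measurable_derivable_coord dphi'.
Qed.

Lemma weight_coord_neq j k (phi phi' : R -> R) C : j != k ->
  (forall y : R, is_derive y 1 phi (phi' y)) -> (forall y, `|phi y| <= C) ->
  weight k (fun x : E => phi (x ord0 j)) (fun=> 0).
Proof.
move=> jk dphi b0; split => //; first exact: measurable_derivable_coord dphi.
have C0 : 0 <= C by exact: le_trans (b0 0).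
exists C; split => // [x|x t _]; first by rewrite normr0.
rewrite translateE (negbTE jk) !mulr0 addr0 subrr subr0 normr0.
by rewrite mulr_ge0 ?sqr_ge0.
Qed.

Lemma is_derive_along f j x (t : R) :
  derivable f (translate j t x) (delta_mx ord0 j) ->
  is_derive t 1 (fun s : R => f (translate j s x)) (partial j f (translate j t
    x)).
Proof.
move=> df.
have e : (fun h : R => h^-1 *: (((fun s : R => f (translate j s x)) \o shift t)
  (h *: 1) -
       f (translate j t x))) =
    (fun h : R => h^-1 *: ((f \o shift (translate j t x)) (h *: delta_mx ord0
      j) -
       f (translate j t x))).
  apply/funext => h /=; rewrite [h *: 1]mulr1 /translate scalerDl.
  by rewrite [h *: delta_mx _ _ + (_ + _)]addrC -addrA [h *: delta_mx _ _ +
    _]addrC.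
by apply: DeriveDef; [rewrite /derivable e|rewrite /derive e].
Qed.

Lemma exp_decay_bounded f : exp_decay f -> exists C : R, forall x, `|f x| <= C.
Proof.
move=> [C [a [a0 H]]]; exists `|C| => x; apply: (le_trans (H x)).
apply: (le_trans (ler_norm _)); rewrite normrM (ger0_norm (expR_ge0 _)).
rewrite ler_piMr// expR_le1 oppr_le0; apply: mulr_ge0; first exact: ltW.
exact: sqrtr_ge0.
Qed.

Lemma smooth_derivable V s j x : smooth V ->
  derivable (partials s V) x (delta_mx ord0 j).
Proof. by move=> sV; have [_ ] := sV (size s).+1 s; apply. Qed.

Lemma smooth_measurable V s : smooth V -> measurable_fun setT (partials s V).
Proof.
move=> sV; apply: continuous_measurable_rV.
by have [+ _] := sV (size s) s; apply.
Qed.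

Lemma weight_potential V j : smooth_exp_decay V -> weight j V (partial j V).
Proof.
move=> [sV dV].
have [C0 H0] := exp_decay_bounded (dV [::]).
have [C1 H1] := exp_decay_bounded (dV [:: j]).
have [C2 H2] := exp_decay_bounded (dV [:: j; j]).
have p0 : 0 <= C0 by exact: le_trans (H0 0).
have p1 : 0 <= C1 by exact: le_trans (H1 0).
have p2 : 0 <= C2 by exact: le_trans (H2 0).
apply: (@weight_C2 _ _ _ (partial j (partial j V)) (C0 + C1 + C2)).
- exact: (smooth_measurable [::] sV).
- exact: (smooth_measurable [:: j] sV).
- move=> x t; apply: is_derive_along.
  exact: (@smooth_derivable V [::] j _ sV).
- move=> x t; apply: is_derive_along.
  exact: (@smooth_derivable V [:: j] j _ sV).
- by move=> x; apply: (le_trans (H0 x)); lra.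
- by move=> x; apply: (le_trans (H1 x)); lra.
- by move=> x; apply: (le_trans (H2 x)); lra.
Qed.

Lemma weight_affine_potential V j (lambda : R) : smooth_exp_decay V ->
  weight j (fun x => lambda - V x) (fun x => - partial j V x).
Proof.
move=> /(weight_potential j)[mV mV' [C [VC V'C VV']]]; split.
- exact: measurable_funB.
- exact: measurable_funN.
exists (`|lambda| + C); split => [x|x|x t t1].
- by apply: (le_trans (ler_normB _ _)); rewrite lerD2l.
- by rewrite normrN (le_trans (V'C x))// lerDr.
- rewrite (_ : _ - _ = - (V (translate j t x) - V x - t * partial j V x));
    last by ring.
  rewrite normrN (le_trans (VV' _ _ t1))// ler_wpM2r ?sqr_ge0// lerDr//.
Qed.

Lemma enorm_ge_coord j x : `|x ord0 j| <= enorm x.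
Proof.
rewrite -sqrtr_sqr /enorm ler_wsqrtr// (bigD1 j)//= lerDl.
by apply: sumr_ge0 => i _; exact: sqr_ge0.
Qed.

(** Exponential decay beats a linear factor, as r e^(- a r) <= 1/a. It makes the
    potential of the commutator bounded. *)
Lemma coord_partial_bounded V j : smooth_exp_decay V ->
  exists C : R, forall x, `|x ord0 j * partial j V x| <= C.
Proof.
move=> [_ /(_ [:: j])[C [a [a0 H]]]]; exists (C / a) => x.
have n0 : 0 <= enorm x by exact: sqrtr_ge0.
have C0 : 0 <= C.
  by have := le_trans (normr_ge0 _) (H x); rewrite pmulr_lge0// expR_gt0.
rewrite normrM; apply: (le_trans (ler_pM _ _ (enorm_ge_coord j x) (H x))) => //.
rewrite mulrCA ler_wpM2l// expRN.
rewrite ler_pdivrMr ?expR_gt0// mulrC -ler_pdivrMr ?invr_gt0// invrK.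
by apply: le_trans (expR_ge1Dx _); rewrite mulrC lerDr.
Qed.

End weights.

(** * The virial identity for a bounded vector field *)

Section virial.
Context {R : realType} {d : nat}.
Local Notation E := 'rV[R]_d.
Local Notation mu := (lebesgue_rV (R := R) d).
Implicit Types (V F G : E -> R) (j k : 'I_d) (x : E) (psi : 'I_d -> R -> R).

(** A choice of weak derivatives up to order two; [u2 j k] is the derivative of
    [u1 j] in direction [k]. *)
Definition weak_hessian (u : E -> R) (u1 : 'I_d -> E -> R) (u2 : 'I_d ->
  'I_d -> E -> R) :=
  (forall j, weak_deriv j u (u1 j)) /\ (forall j k,
    weak_deriv k (u1 j) (u2 j k)).

Lemma partial_tensorC psi j k : Ccinfty_factors psi ->
  partial j (partial k (tensor psi)) = partial k (partial j (tensor psi)).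
Proof.
move=> bpsi; have [->//|jk] := eqVneq j k.
have bk := Ccinfty_factors_set_factor k bpsi (Ccinfty_derive (bpsi k)).
have bj := Ccinfty_factors_set_factor j bpsi (Ccinfty_derive (bpsi j)).
rewrite (@partial_tensor _ _ psi k bpsi) (@partial_tensor _ _ psi j bpsi).
rewrite (@partial_tensor _ _ _ j bk) (@partial_tensor _ _ _ k bj).
apply/funext => x; apply: eq_bigr => i _; rewrite /set_factor.
rewrite [k == j]eq_sym !(negbTE jk).
have [ij|ij] := eqVneq i j; have [ik|ik] := eqVneq i k => //.
by move: jk; rewrite -ij ik eqxx.
Qed.

(** Both mixed derivatives act on a product of bumps through its own second
    partial derivatives, and those commute. *)
Lemma weak_deriv_commute u u1 u2 j k : weak_hessian u u1 u2 ->
  {ae mu, forall x, u2 j k x = u2 k j x}.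
Proof.
move=> [D1 D2].
have U2 i l : L2r (u2 i l) by have [] := D2 i l.
have step i l psi : Ccinfty_factors psi ->
  \int[mu]_x (u2 i l x * tensor psi x) =
    \int[mu]_x (u x * partial i (partial l (tensor psi)) x).
  move=> bpsi; have [_ _ H2] := D2 i l; have [_ _ H1] := D1 i.
  have bl := Ccinfty_factors_set_factor l bpsi (Ccinfty_derive (bpsi l)).
  by rewrite -[LHS]opprK -H2// (@partial_tensor _ _ psi l bpsi) H1// opprK.
have : {ae mu, forall x, u2 j k x - u2 k j x = 0}.
  have L : L2r (fun x => u2 j k x - u2 k j x) by exact: L2rB.
  apply: tensor_orthogonal_ae0 => [|h Lh|psi bpsi].
  - by have [] := L.
  - exact: L2r_mul.
  - have T := L2r_tensor bpsi; under eq_Rintegral do rewrite mulrBl.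
    rewrite IntB; [|exact: L2r_mul|exact: L2r_mul].
    by rewrite !step// partial_tensorC// subrr.
by apply: filterS => x /= /eqP; rewrite subr_eq0 => /eqP.
Qed.

Section cutoff.
Variables (j : 'I_d) (a0 a1 a2 a3 a4 : R -> R) (C : R).
Hypothesis d0 : forall y : R, is_derive y 1 a0 (a1 y).
Hypothesis d1 : forall y : R, is_derive y 1 a1 (a2 y).
Hypothesis d2 : forall y : R, is_derive y 1 a2 (a3 y).
Hypothesis d3 : forall y : R, is_derive y 1 a3 (a4 y).
Hypothesis b0 : forall y, `|a0 y| <= C.
Hypothesis b1 : forall y, `|a1 y| <= C.
Hypothesis b2 : forall y, `|a2 y| <= C.
Hypothesis b3 : forall y, `|a3 y| <= C.
Hypothesis b4 : forall y, `|a4 y| <= C.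

Let w0 : weight j (fun x : E => a0 (x ord0 j)) (fun x => a1 (x ord0 j)).
Proof. exact: weight_coord d0 d1 b0 b1 b2. Qed.

Let w1 : weight j (fun x : E => a1 (x ord0 j)) (fun x => a2 (x ord0 j)).
Proof. exact: weight_coord d1 d2 b1 b2 b3. Qed.

Let w2 : weight j (fun x : E => a2 (x ord0 j)) (fun x => a3 (x ord0 j)).
Proof. exact: weight_coord d2 d3 b2 b3 b4. Qed.

(** The generator of the flow of the vector field [a0 (x_j) e_j], made skew-
    adjoint by half its divergence. *)
Definition dilation (u uj : E -> R) x : R :=
  a0 (x ord0 j) * uj x + 2^-1 * a1 (x ord0 j) * u x.

(** Half the commutator of the Schrodinger operator with the dilation, as a
    quadratic form; for [a0] the identity it is the part of the commutator form
    that belongs to direction [j]. *)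
Definition virial_density V (u uj : E -> R) x : R :=
  a1 (x ord0 j) * uj x ^+ 2 - 4^-1 * a3 (x ord0 j) * u x ^+ 2 +
  2^-1 * (a0 (x ord0 j) * partial j V x) * u x ^+ 2.

Lemma measurable_virial_density V (u uj : E -> R) :
  measurable_fun setT (fun x : E => a0 (x ord0 j)) ->
  measurable_fun setT (fun x : E => a1 (x ord0 j)) ->
  measurable_fun setT (fun x : E => a3 (x ord0 j)) ->
  smooth V -> measurable_fun setT u -> measurable_fun setT uj ->
  measurable_fun setT (virial_density V u uj).
Proof.
move=> m0 m1 m3 sV mu0 mu1; apply: measurable_funD.
  apply: measurable_funB; apply: measurable_funM => //;
    [exact: measurable_funX| |].
    exact: measurable_funM.
  exact: measurable_funX.
apply: measurable_funM; last exact: measurable_funX.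
apply: measurable_funM => //; apply: measurable_funM => //.
exact: (smooth_measurable [:: j] sV).
Qed.

Lemma null_dilation_skew p p' q q' : weak_deriv j p p' -> weak_deriv j q q' ->
  null_integral (fun x => q x * dilation p p' x + p x * dilation q q' x).
Proof.
move=> pp' qq'; have := null_by_parts w0 pp' qq'; congr null_integral.
by apply/funext => x; rewrite /dilation; field.
Qed.

(** For k = j, three integrations by parts produce the two terms of the density
    that contain no potential. For k <> j the field does not depend on x_k, so
    integration by parts in x_k turns u_kk into u_k paired with the dilation of
    u_k, which is 0 by skewness; this uses that mixed derivatives commute. *)
Lemma null_dilation_laplacian u u1 u2 k : weak_hessian u u1 u2 ->
  null_integral (fun x => - u2 k k x * dilation u (u1 j) x -
    (k == j)%:R * (a1 (x ord0 j) * u1 j x ^+ 2 - 4^-1 * a3 (x ord0 j) * u x ^+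
      2)).
Proof.
move=> H; have [D1 D2] := H.
have [->|kj] := eqVneq k j.
  have N4 := null_by_parts w0 (D2 j j) (D2 j j).
  have N5 := null_by_parts w1 (D2 j j) (D1 j).
  have N6 := null_by_parts w2 (D1 j) (D1 j).
  have := null_integralD (null_integralD (null_integralZ (- 2^-1) N4)
    (null_integralZ (- 2^-1) N5)) (null_integralZ 4^-1 N6).
  by congr null_integral; apply/funext => x; rewrite /dilation mul1r; field.
have jk : j != k by rewrite eq_sym.
have v0 := weight_coord_neq jk d0 b0.
have v1 := weight_coord_neq jk d1 b1.
have N2 := null_by_parts v0 (D2 k k) (D2 j k).
have N3 := null_by_parts v1 (D2 k k) (D1 k).
have N4 := null_by_parts w0 (D2 k j) (D2 k j).
have Nc : null_integral (fun x => a0 (x ord0 j) * u1 k x * (u2 j k x - u2 k j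
  x)).
  apply: (@null_ae _ _ (fun=> 0)).
  - by split; [exact: (integrable0 mu setT)|exact: Int0].
  - have [m0 _ [C0 [W0 _ _]]] := w0.
    have [U1 _ _] := D2 k j; have [_ U2 _] := D2 j k; have [_ U2' _] := D2 k j.
    exact: L1r_measurable (L2r_mul (L2r_bounded_mul m0 W0 U1) (L2rB U2 U2')).
  - by apply: filterS (weak_deriv_commute j k H) => x /= ->;
      rewrite subrr mulr0.
have := null_integralD (null_integralD (null_integralZ (-1) N2) (null_integralZ
  (- 2^-1) N3)) (null_integralD Nc (null_integralZ 2^-1 N4)).
by congr null_integral; apply/funext => x; rewrite /dilation mulr0n; field.
Qed.

(** The potential contributes the derivative of a0 (lambda - V) u^2 / 2, except
    for the term in which V is differentiated. *)
Lemma null_virial V lambda u u1 u2 : smooth_exp_decay V ->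
  weak_hessian u u1 u2 ->
  null_integral (fun x => (- (\sum_k u2 k k x) +
    (lambda - V x) * u x) * dilation u (u1 j) x -
    virial_density V u (u1 j) x).
Proof.
move=> sV H; have [D1 D2] := H.
have N1 := null_by_parts (weightM (weight_affine_potential j lambda sV) w0) (D1
  j) (D1 j).
have NZ := null_sum (index_enum 'I_d) (fun k => null_dilation_laplacian k H).
have := null_integralD NZ (null_integralZ 2^-1 N1); congr null_integral;
  apply/funext => x.
pose c := a1 (x ord0 j) * u1 j x ^+ 2 - 4^-1 * a3 (x ord0 j) * u x ^+ 2.
have S : \sum_k - ((k == j)%:R * c) = - c.
  rewrite (bigD1 j)//= eqxx mul1r big1 ?addr0// => k /negbTE ->.
  by rewrite mul0r oppr0.
rewrite big_split/= -mulr_suml sumrN S /c.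
by rewrite /dilation /virial_density; field.
Qed.

(** The equations replace the two operators by tau q and tau p, and the dilation
    is skew. *)
Lemma null_virial_pair V1 V2 lambda tau p p1 p2 q q1 q2 :
  smooth_exp_decay V1 -> smooth_exp_decay V2 ->
  weak_hessian p p1 p2 -> weak_hessian q q1 q2 ->
  {ae mu, forall x, - (\sum_k p2 k k x) + (lambda - V1 x) * p x = tau * q x} ->
  {ae mu, forall x, - (\sum_k q2 k k x) + (lambda - V2 x) * q x = tau * p x} ->
  null_integral (fun x => virial_density V1 p (p1 j) x +
    virial_density V2 q (q1 j) x).
Proof.
move=> sV1 sV2 P Q eP eQ; have [P1 _] := P; have [Q1 _] := Q.
have NP := null_virial lambda sV1 P; have NQ := null_virial lambda sV2 Q.
have skew := null_dilation_skew (P1 j) (Q1 j).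
have Np : {ae mu, forall x,
    ((- (\sum_k p2 k k x) + (lambda - V1 x) * p x) * dilation p (p1 j) x -
      virial_density V1 p (p1 j) x) +
    ((- (\sum_k q2 k k x) + (lambda - V2 x) * q x) * dilation q (q1 j) x -
      virial_density V2 q (q1 j) x) =
    tau * (q x * dilation p (p1 j) x + p x * dilation q (q1 j) x) -
    (virial_density V1 p (p1 j) x + virial_density V2 q (q1 j) x)}.
  by apply: filterS2 eP eQ => x /= -> ->; ring.
have [m0 m1 _] := w0; have [_ m3 _] := w2.
have mvir V u u1 : smooth_exp_decay V -> weak_deriv j u u1 ->
    measurable_fun setT (virial_density V u u1).
  by move=> [sV _] [[mu0 _] [mu1 _] _]; exact: measurable_virial_density.
have mG : measurable_fun setT (fun x =>
    tau * (q x * dilation p (p1 j) x + p x * dilation q (q1 j) x) -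
    (virial_density V1 p (p1 j) x + virial_density V2 q (q1 j) x)).
  apply: measurable_funB; last first.
    by apply: measurable_funD; [exact: mvir (P1 j)|exact: mvir (Q1 j)].
  by apply: measurable_funM => //; exact: L1r_measurable (skew.1).
have := null_integralD (null_integralZ (-1) (null_ae (null_integralD NP NQ) mG
  Np)) (null_integralZ tau skew).
by congr null_integral; apply/funext => x; ring.
Qed.

End cutoff.

End virial.

(** * Sine vector fields *)

Section sine_cutoff.
Context {R : realType}.
Implicit Types (e y z : R).

Lemma is_derive_sin_scale e y :
  is_derive y 1 (fun y : R => sin (e * y)) (e * cos (e * y)).
Proof.
have := @is_derive_affine R sin (cos (e * y + 0)) e 0 y (is_derive_sin _).
by rewrite addr0; congr is_derive; apply/funext => z; rewrite addr0.
Qed.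

Lemma is_derive_cos_scale e y :
  is_derive y 1 (fun y : R => cos (e * y)) (- (e * sin (e * y))).
Proof.
have := @is_derive_affine R cos (- sin (e * y + 0)) e 0 y (is_derive_cos _).
by rewrite addr0 mulrN; congr is_derive; apply/funext => z; rewrite addr0.
Qed.

Lemma is_derive_scale (c : R) (f : R -> R) (f' y : R) :
  is_derive y 1 f f' -> is_derive y 1 (fun y : R => c * f y) (c * f').
Proof. by move=> df; exact: (@is_deriveZ _ _ _ f c y 1 f' df). Qed.

Lemma norm_sin_le z : `|sin z| <= `|z|.
Proof.
have := @norm_increment_le R sin cos 1 z (fun s => is_derive_sin s) (fun s _ =>
  cos_max s).
by rewrite sin0 subr0 mul1r.
Qed.

Lemma norm_sin_sub_le z : `|sin z - z| <= z ^+ 2.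
Proof.
have D (s : R) : is_derive s 1 (fun s => sin s - s) (cos s - 1).
  exact: is_deriveB (is_derive_sin s) (is_derive_id s 1).
have := @norm_increment_le R (fun s => sin s - s) _ `|z| z D _.
rewrite sin0 !subr0 -expr2 real_normK ?num_real//; apply=> s sz.
have C (r : R) : is_derive r 1 cos (- sin r) by exact: is_derive_cos.
have B (r : R) : `|- sin r| <= 1 by rewrite normrN sin_max.
have := @norm_increment_le R cos _ 1 s C (fun r _ => B r).
by rewrite cos0 mul1r => /le_trans; apply.
Qed.

(** The field sin (e y) / e, bounded for e > 0 and tending to y as e tends to 0;
    [dil1] to [dil4] are its derivatives. *)
Definition dil0 e y := e^-1 * sin (e * y).
Definition dil1 e y := cos (e * y).
Definition dil2 e y := - (e * sin (e * y)).
Definition dil3 e y := - e * (e * cos (e * y)).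
Definition dil4 e y := - e * (e * - (e * sin (e * y))).

Lemma is_derive_dil0 e y : e != 0 -> is_derive y 1 (dil0 e) (dil1 e y).
Proof.
move=> e0; have := is_derive_scale e^-1 (is_derive_sin_scale e y).
by rewrite mulKf.
Qed.

Lemma is_derive_dil1 e y : is_derive y 1 (dil1 e) (dil2 e y).
Proof. exact: is_derive_cos_scale. Qed.

Lemma is_derive_dil2 e y : is_derive y 1 (dil2 e) (dil3 e y).
Proof.
have := is_derive_scale (- e) (is_derive_sin_scale e y).
by congr is_derive; apply/funext => z; rewrite /dil2 mulNr.
Qed.

Lemma is_derive_dil3 e y : is_derive y 1 (dil3 e) (dil4 e y).
Proof. by do 2 apply: is_derive_scale; exact: is_derive_cos_scale. Qed.

Section bounds.
Variables (e y : R).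
Hypotheses (e0 : 0 < e) (e1 : e <= 1).

Let ne : `|e| = e. Proof. by rewrite gtr0_norm. Qed.

Lemma norm_dil0 : `|dil0 e y| <= e^-1 + 1.
Proof.
rewrite normrM normfV ne; apply: (@le_trans _ _ e^-1); last by rewrite lerDl.
by rewrite ler_piMr ?sin_max// invr_ge0 ltW.
Qed.

Lemma norm_dil1 : `|dil1 e y| <= 1. Proof. exact: cos_max. Qed.

Lemma norm_dil2 : `|dil2 e y| <= 1.
Proof. by rewrite normrN normrM ne mulr_ile1// ?sin_max// ltW. Qed.

Lemma norm_dil3 : `|dil3 e y| <= 1.
Proof.
rewrite normrM normrN ne mulr_ile1//; first exact: ltW.
by rewrite normrM ne mulr_ile1// ?cos_max// ltW.
Qed.

Lemma norm_dil4 : `|dil4 e y| <= 1.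
Proof.
rewrite normrM normrN ne mulr_ile1//; first exact: ltW.
by rewrite normrM ne mulr_ile1// ?norm_dil2// ltW.
Qed.

Lemma norm_dil0_le : `|dil0 e y| <= `|y|.
Proof.
rewrite normrM normfV ne ler_pdivrMl//.
by apply: (le_trans (norm_sin_le _)); rewrite normrM ne.
Qed.

Lemma dil0_sub_le : `|dil0 e y - y| <= e * y ^+ 2.
Proof.
have -> : dil0 e y - y = e^-1 * (sin (e * y) - e * y).
  by rewrite /dil0 mulrBr mulKf// gt_eqF.
rewrite normrM normfV ne ler_pdivrMl//.
by apply: (le_trans (norm_sin_sub_le _)); rewrite mulrA exprMn -expr2.
Qed.

End bounds.

Definition eps n : R := n.+1%:R^-1.

Lemma eps_gt0 n : 0 < eps n. Proof. by rewrite invr_gt0. Qed.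
Lemma eps_le1 n : eps n <= 1. Proof. by rewrite invf_le1// ler1n. Qed.

Lemma cvg_dil0 y : dil0 (eps n) y @[n --> \oo] --> y.
Proof.
suff : (dil0 (eps n) y - y) @[n --> \oo] --> (0 : R).
  by move/cvg_sub0; apply; exact: cvg_cst.
apply: norm_cvg0; apply: (@squeeze_cvgr _ _ _ _ (fun=> 0) (fun n => eps n * y
  ^+ 2)).
- by near=> n; rewrite normr_ge0/=; apply: dil0_sub_le; [exact: eps_gt0].
- exact: cvg_cst.
- rewrite -[X in _ --> X](mul0r (y ^+ 2)); apply: cvgM; last exact: cvg_cst.
  exact: cvg_harmonic.
Unshelve. all: by end_near. Qed.

Lemma cvg_cos_eps y : cos (eps n * y) @[n --> \oo] --> (1 : R).
Proof.
rewrite -[X in _ --> X](cos0 R) -[X in cos X](mul0r y).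
apply: continuous_cvg; first exact: continuous_cos.
by apply: cvgM; [exact: cvg_harmonic|exact: cvg_cst].
Qed.

Lemma cvg_dil3 y : dil3 (eps n) y @[n --> \oo] --> (0 : R).
Proof.
have h : eps n @[n --> \oo] --> (0 : R) by exact: cvg_harmonic.
have := cvgM (cvgN h) (cvgM h (cvg_cos_eps y)).
by rewrite mul0r mulr0; apply.
Qed.

End sine_cutoff.

(** * Removal of the cutoff *)

Section energy.
Context {R : realType} {d : nat}.
Local Notation E := 'rV[R]_d.
Local Notation mu := (lebesgue_rV (R := R) d).
Implicit Types (V F G : E -> R) (j k : 'I_d) (x : E).

Definition energy1 j V (p pj : E -> R) x : R :=
  pj x ^+ 2 + 2^-1 * (x ord0 j * partial j V x) * p x ^+ 2.

Lemma L1r_energy1 j V p pj : smooth_exp_decay V -> L2r p -> L2r pj ->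
  L1r (energy1 j V p pj).
Proof.
move=> sV P [mpj Pj]; have [K HK] := coord_partial_bounded j sV.
have mx : measurable_fun setT (fun x : E => 2^-1 * (x ord0 j * partial j V x)).
  apply: measurable_funM => //; apply: measurable_funM;
    first exact: measurable_coord.
  exact: (smooth_measurable [:: j] sV.1).
apply: L1rD => //.
have -> : (fun x : E => 2^-1 * (x ord0 j * partial j V x) * p x ^+ 2) =
    fun x => (2^-1 * (x ord0 j * partial j V x) * p x) * p x.
  by apply/funext => x; rewrite expr2 mulrA.
apply: L2r_mul => //; apply: (L2r_bounded_mul mx (C := 2^-1 * K)) => // x.
by rewrite normrM ger0_norm ?invr_ge0// ler_wpM2l ?invr_ge0.
Qed.

(** The bound does not depend on [n], since |sin (e y) / e| <= |y|. *)
Lemma virial_density_le n j V p pj K x : (forall x,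
  `|x ord0 j * partial j V x| <= K) ->
  `|virial_density j (dil0 (eps n)) (dil1 (eps n)) (dil3 (eps n)) V p pj x| <=
  pj x ^+ 2 + (4^-1 * p x ^+ 2 + (2^-1 * K) * p x ^+ 2).
Proof.
move=> HK; have en0 := eps_gt0 n; have en1 := eps_le1 n.
rewrite /virial_density -addrA; apply: (le_trans (ler_normD _ _)); apply: lerD.
  by rewrite normrM (ger0_norm (sqr_ge0 _)) ler_piMl ?sqr_ge0// norm_dil1.
apply: (le_trans (ler_normD _ _)); apply: lerD.
  rewrite normrN normrM (ger0_norm (sqr_ge0 _)) ler_wpM2r ?sqr_ge0//.
  by rewrite normrM ger0_norm ?invr_ge0// ler_piMr ?invr_ge0// norm_dil3.
rewrite normrM (ger0_norm (sqr_ge0 _)) ler_wpM2r ?sqr_ge0//.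
rewrite normrM ger0_norm ?invr_ge0// ler_wpM2l ?invr_ge0//.
apply: le_trans (HK x); rewrite normrM [X in _ <= X]normrM ler_wpM2r//.
exact: norm_dil0_le.
Qed.

Lemma Int_virial_cvg j V p pj : smooth_exp_decay V -> L2r p -> L2r pj ->
  (forall n, L1r (virial_density j (dil0 (eps n)) (dil1 (eps n)) (dil3 (eps n))
    V p pj)) /\
  \int[mu]_x virial_density j (dil0 (eps n)) (dil1 (eps n)) (dil3 (eps n)) V p
    pj x
    @[n --> \oo] --> \int[mu]_x energy1 j V p pj x.
Proof.
move=> sV P Pj; have [K HK] := coord_partial_bounded j sV.
have [[mp p2] [mpj pj2]] := (P, Pj); have [smV _] := sV.
have mvir n : measurable_fun setT
    (virial_density j (dil0 (eps n)) (dil1 (eps n)) (dil3 (eps n)) V p pj).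
  have en0 : eps n != 0 :> R by rewrite gt_eqF// eps_gt0.
  apply: measurable_virial_density => //.
  - exact: (measurable_derivable_coord j (fun y => is_derive_dil0 y en0)).
  - exact: (measurable_derivable_coord j (is_derive_dil1 (eps n))).
  - exact: (measurable_derivable_coord j (is_derive_dil3 (eps n))).
have iH : L1r (fun x => pj x ^+ 2 + (4^-1 * p x ^+ 2 + (2^-1 * K) * p x ^+ 2)).
  by apply: L1rD => //; apply: L1rD; exact: L1rZ.
split.
  move=> n; apply: L1r_le iH _ => //.
  by move=> x; exact: virial_density_le.
apply: Int_dominated_cvg iH _.
- by [].
- exact: L1r_measurable (L1r_energy1 j sV P Pj).
- move=> x; rewrite /virial_density /energy1.
  have cst (c : R) : c @[_ --> \oo] --> c by exact: cvg_cst.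
  have -> : pj x ^+ 2 + 2^-1 * (x ord0 j * partial j V x) * p x ^+ 2 =
      1 * pj x ^+ 2 - 4^-1 * 0 * p x ^+ 2 +
      2^-1 * (x ord0 j * partial j V x) * p x ^+ 2 by ring.
  apply: cvgD; first apply: cvgB.
  - by apply: cvgM (cst _); exact: cvg_cos_eps.
  - by apply: cvgM (cst _); apply: cvgM (cst _) _; exact: cvg_dil3.
  - apply: cvgM (cst _); apply: cvgM (cst _) _.
    by apply: cvgM (cst _); exact: cvg_dil0.
- by move=> n x; exact: virial_density_le.
Qed.

(** The density of [calL_form] for a real function with gradient [p1]. *)
Definition energy V (p : E -> R) (p1 : 'I_d -> E -> R) x : R :=
  \sum_j p1 j x ^+ 2 + calV V x * p x ^+ 2.

Lemma energyE V p p1 x : energy V p p1 x = \sum_j energy1 j V p (p1 j) x.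
Proof.
rewrite /energy /energy1 big_split/= -mulr_suml -mulr_sumr.
by rewrite /calV /radial_derive.
Qed.

Lemma L1r_energy V p p1 p2 : smooth_exp_decay V -> weak_hessian p p1 p2 ->
  L1r (energy V p p1).
Proof.
move=> sV [P1 _]; rewrite (_ : energy _ _ _ =
  fun x => \sum_j energy1 j V p (p1 j) x).
  apply: L1r_sum => j; have [P Pj _] := P1 j; exact: L1r_energy1.
by apply/funext => x; exact: energyE.
Qed.

(** In each direction the two densities have integrals with sum 0 for every
    cutoff; let the cutoff tend to the identity, and add the directions. *)
Lemma virial_identity V1 V2 lambda tau p p1 p2 q q1 q2 :
  smooth_exp_decay V1 -> smooth_exp_decay V2 ->
  weak_hessian p p1 p2 -> weak_hessian q q1 q2 ->
  {ae mu, forall x, - (\sum_k p2 k k x) + (lambda - V1 x) * p x = tau * q x} ->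
  {ae mu, forall x, - (\sum_k q2 k k x) + (lambda - V2 x) * q x = tau * p x} ->
  \int[mu]_x energy V1 p p1 x + \int[mu]_x energy V2 q q1 x = 0.
Proof.
move=> sV1 sV2 P Q eP eQ; have [P1 _] := P; have [Q1 _] := Q.
rewrite -IntD; [|exact: L1r_energy P|exact: L1r_energy Q].
under eq_Rintegral do rewrite !energyE -big_split/=.
have ij j : L1r (fun x => energy1 j V1 p (p1 j) x + energy1 j V2 q (q1 j) x).
  by have [P0 Pj _] := P1 j; have [Q0 Qj _] := Q1 j; apply: L1rD;
    exact: L1r_energy1.
rewrite Int_sum//; apply: big1 => j _.
have [P0 Pj _] := P1 j; have [Q0 Qj _] := Q1 j.
rewrite IntD; [|exact: L1r_energy1|exact: L1r_energy1].
have [i1 lim1] := Int_virial_cvg j sV1 P0 Pj.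
have [i2 lim2] := Int_virial_cvg j sV2 Q0 Qj.
apply: (cvg_unique _ (cvgD lim1 lim2)) => //.
apply: cvg_near_cst; apply: nearW => n.
apply: etrans (esym (IntD (i1 n) (i2 n))) _.
have e0 : 0 < eps n :> R by exact: eps_gt0.
have e1 : eps n <= 1 :> R by exact: eps_le1.
have en : eps n != 0 :> R by rewrite gt_eqF.
have C1 : 1 <= (eps n)^-1 + 1 :> R by rewrite lerDr invr_ge0; exact: ltW.
apply: (null_virial_pair j (a0 := dil0 (eps n)) (a1 := dil1 (eps n))
  (a2 := dil2 (eps n)) (a3 := dil3 (eps n)) (a4 := dil4 (eps n))
  (C := (eps n)^-1 + 1) _ _ _ _ _ _ _ _ _ sV1 sV2 P Q eP eQ).2 => y.
- exact: is_derive_dil0.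
- exact: is_derive_dil1.
- exact: is_derive_dil2.
- exact: is_derive_dil3.
- exact: norm_dil0.
- exact: le_trans (norm_dil1 _ _) C1.
- exact: le_trans (norm_dil2 _ e0 e1) C1.
- exact: le_trans (norm_dil3 _ e0 e1) C1.
- exact: le_trans (norm_dil4 _ e0 e1) C1.
Qed.

End energy.

(** * Eigenvectors *)

Section complex_parts.
Context {R : realType} {d : nat}.
Local Notation E := 'rV[R]_d.
Local Notation mu := (lebesgue_rV (R := R) d).
Local Notation Re := (@complex.Re R).
Local Notation Im := (@complex.Im R).
Implicit Types (V : E -> R) (j k : 'I_d) (x : E) (u v w : E -> R[i]).

Lemma ReD (a b : R[i]) : Re (a + b) =
  Re a + Re b. Proof. by case: a b => ? ? []. Qed.
Lemma ImD (a b : R[i]) : Im (a + b) =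
  Im a + Im b. Proof. by case: a b => ? ? []. Qed.
Lemma ReN (a : R[i]) : Re (- a) = - Re a. Proof. by case: a. Qed.
Lemma ImN (a : R[i]) : Im (- a) = - Im a. Proof. by case: a. Qed.

Lemma ReMr (a : R[i]) (r : R) : Re (a * r%:C%C) = Re a * r.
Proof. by case: a => a b /=; rewrite mulr0 subr0. Qed.

Lemma ImMr (a : R[i]) (r : R) : Im (a * r%:C%C) = Im a * r.
Proof. by case: a => a b /=; rewrite mulr0 add0r. Qed.

Lemma Re_sum (F : 'I_d -> R[i]) : Re (\sum_j F j) = \sum_j Re (F j).
Proof. exact: (big_morph Re ReD). Qed.

Lemma Im_sum (F : 'I_d -> R[i]) : Im (\sum_j F j) = \sum_j Im (F j).
Proof. exact: (big_morph Im ImD). Qed.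

Lemma L2_parts u : L2 u -> L2r (fun x => Re (u x)) /\ L2r (fun x => Im (u x)).
Proof.
move=> [mr mi fin].
have mabs : measurable_fun setT (fun x => abs2 (u x)).
  by apply: measurable_funD; exact: measurable_funX.
have iabs : L1r (fun x => abs2 (u x)).
  apply/integrableP; split; first exact/measurable_EFinP.
  rewrite (eq_integral (fun x => (abs2 (u x))%:E)); first exact: fin.
  by move=> x _ /=; rewrite ger0_norm// addr_ge0 ?sqr_ge0.
split; split => //; apply: L1r_le iabs _;
  [exact: measurable_funX| |exact: measurable_funX|];
  by move=> x; rewrite ger0_norm ?sqr_ge0// /abs2 ?lerDl ?lerDr sqr_ge0.
Qed.

Lemma is_weak_partial_parts j u w : L2 u -> is_weak_partial j u w ->
  weak_deriv j (fun x => Re (u x)) (fun x => Re (w x)) /\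
  weak_deriv j (fun x => Im (u x)) (fun x => Im (w x)).
Proof.
move=> Lu [Lw H].
have [ur ui] := L2_parts Lu; have [wr wi] := L2_parts Lw.
split; split => // psi bpsi.
- have /(congr1 Re) := H _ (test_function_tensor bpsi).
  rewrite /cintegral/=.
  under eq_Rintegral do rewrite ReMr.
  by under [X in _ = - X]eq_Rintegral do rewrite ReMr.
- have /(congr1 Im) := H _ (test_function_tensor bpsi).
  rewrite /cintegral/=.
  under eq_Rintegral do rewrite ImMr.
  by under [X in _ = - X]eq_Rintegral do rewrite ImMr.
Qed.

Lemma weak_partialP u j : H1 u -> is_weak_partial j u (weak_partial j u).
Proof.
by move=> [_ /(_ j) H]; exact: (@xgetPex _ (fun=> 0) [set w | is_weak_partial j
  u w] H).
Qed.

Lemma H2_parts u : H2 u ->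
  weak_hessian (fun x => Re (u x)) (fun j x => Re (weak_partial j u x))
    (fun j k x => Re (weak_partial k (weak_partial j u) x)) /\
  weak_hessian (fun x => Im (u x)) (fun j x => Im (weak_partial j u x))
    (fun j k x => Im (weak_partial k (weak_partial j u) x)).
Proof.
move=> [Hu Hj]; have [Lu _] := Hu.
have A j := is_weak_partial_parts Lu (weak_partialP j Hu).
have B j k := is_weak_partial_parts (Hj j).1 (weak_partialP k (Hj j)).
by split; split => [j|j k]; [exact: (A j).1|exact: (B j k).1|exact: (A
  j).2|exact: (B j k).2].
Qed.

Lemma Re_schrodinger lambda V u x : Re (schrodinger lambda V u x) =
  - (\sum_k Re (weak_partial k (weak_partial k u) x)) +
      (lambda - V x) * Re (u x).
Proof.
rewrite /schrodinger ReD ReN /weak_laplacian Re_sum; congr (_ + _).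
by rewrite [_ * u x]mulrC ReMr mulrC.
Qed.

Lemma Im_schrodinger lambda V u x : Im (schrodinger lambda V u x) =
  - (\sum_k Im (weak_partial k (weak_partial k u) x)) +
      (lambda - V x) * Im (u x).
Proof.
rewrite /schrodinger ImD ImN /weak_laplacian Im_sum; congr (_ + _).
by rewrite [_ * u x]mulrC ImMr mulrC.
Qed.

Lemma calL_form_parts V u : smooth_exp_decay V -> H2 u ->
  calL_form V u =
  \int[mu]_x energy V (fun x => Re (u x)) (fun j x => Re (weak_partial j u x))
    x +
  \int[mu]_x energy V (fun x => Im (u x)) (fun j x => Im (weak_partial j u x))
    x.
Proof.
move=> sV /H2_parts[hr hi].
rewrite -IntD; [|exact: L1r_energy hr|exact: L1r_energy hi].
apply: eq_Rintegral => x _; rewrite /grad2 /energy /abs2 big_split/=; ring.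
Qed.

(** The eigenvalue equation separates into L_+ Re u = tau Im v with L_- Im v =
    tau Re u, and the same for Im u and Re v with - tau; the virial identity
    applies to both pairs. *)
Lemma B_form_eigenvector lambda tau Vp Vm (z : (E -> R[i]) * (E -> R[i])) :
  smooth_exp_decay Vp -> smooth_exp_decay Vm ->
  eigenvector lambda Vp Vm (0 +i* tau)%C z -> B_form Vp Vm z = 0.
Proof.
case: z => u v sVp sVm [/= Hu Hv _ Heq].
have [ur ui] := H2_parts Hu; have [vr vi] := H2_parts Hv.
have mulI (a : R[i]) : Re ((0 +i* tau)%C * a) = - tau * Im a /\
    Im ((0 +i* tau)%C * a) = tau * Re a.
  by case: a => a b /=; rewrite !mul0r sub0r add0r mulNr.
have e1 : {ae mu, forall x, - (\sum_k Re (weak_partial k (weak_partial k u) x))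
  +
    (lambda - Vp x) * Re (u x) = tau * Im (v x)}.
  apply: filterS Heq => x [_ /(congr1 Re)].
  by rewrite ReN Re_schrodinger (mulI _).1 mulNr => /oppr_inj.
have e2 : {ae mu, forall x, - (\sum_k Im (weak_partial k (weak_partial k v) x))
  +
    (lambda - Vm x) * Im (v x) = tau * Re (u x)}.
  apply: filterS Heq => x [/(congr1 Im) + _].
  by rewrite Im_schrodinger (mulI _).2.
have e3 : {ae mu, forall x, - (\sum_k Im (weak_partial k (weak_partial k u) x))
  +
    (lambda - Vp x) * Im (u x) = - tau * Re (v x)}.
  apply: filterS Heq => x [_ /(congr1 Im)].
  by rewrite ImN Im_schrodinger (mulI _).2 mulNr => <-; rewrite opprK.
have e4 : {ae mu, forall x, - (\sum_k Re (weak_partial k (weak_partial k v) x))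
  +
    (lambda - Vm x) * Re (v x) = - tau * Im (u x)}.
  apply: filterS Heq => x [/(congr1 Re) + _].
  by rewrite Re_schrodinger (mulI _).1.
have I1 := virial_identity sVp sVm ur vi e1 e2.
have I2 := virial_identity sVp sVm ui vr e3 e4.
rewrite /B_form/= !calL_form_parts//.
have sum0 (a b c e : R) : a + e = 0 -> b + c = 0 -> a + b + (c + e) = 0.
  by move=> h1 h2; rewrite [c + e]addrC addrACA h1 h2 addr0.
exact: sum0 I1 I2.
Qed.

End complex_parts.

Theorem theorem1 (R : realType) (d : nat) (hd : (1 <= d)%N)
    (g : R -> R) (g_ge0 : forall s : R, 0 <= g s)
    (lambda : R) (lambda_gt0 : 0 < lambda)
    (Q : 'rV[R]_d -> R) (hQ : soliton g lambda Q)
    (g_derivable : forall x : 'rV[R]_d, derivable g (Q x ^+ 2) 1)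
    (hVp : smooth_exp_decay (V_plus g Q))
    (hVm : smooth_exp_decay (V_minus g Q))
    (U : set (('rV[R]_d -> R[i]) * ('rV[R]_d -> R[i])))
    (hU : H1_subspace U)
    (hSP : spectral_property (V_plus g Q) (V_minus g Q) U) :
  ~ exists k : R[i], exists z : ('rV[R]_d -> R[i]) * ('rV[R]_d -> R[i]),
      [/\ JL_ess_spectrum lambda k, U z &
          eigenvector lambda (V_plus g Q) (V_minus g Q) k z].
Proof.
move=> [k [z [[tau _ ->] Uz ez]]]; have [_ _ nz _] := ez.
have [delta delta0 /(_ z Uz nz)] := hSP.
rewrite (B_form_eigenvector hVp hVm ez) ltNge => /negP; apply.
apply: mulr_ge0; first exact: ltW.
apply: Rintegral_ge0 => x _.
have abs2_ge0 (a : R[i]) : 0 <= abs2 a by rewrite addr_ge0// sqr_ge0.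
apply: addr_ge0; first by apply: addr_ge0; apply: sumr_ge0 => j _.
by apply: mulr_ge0; [exact: expR_ge0|exact: addr_ge0].
Qed.
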